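(* Let $L,a,b,c>0$ be constants and let $p\in L^1[0,L]$ satisfy $$\frac{2a^2M^2}{bL^2N}>\|p\|_1 .$$ Then the operator $A:L^1[0,L]\to L^1[0,L]$ (defined in the context) has a unique fixed point $\varphi$ in the closed ball $B[0,2\|p\|_1]=\{\varphi\in L^1[0,L]:\|\varphi\|_1\le 2\|p\|_1\}$. Consequently, the boundary value problem $$w''''(x)-\Big(a+b\int_0^Lw(t)\,dt\Big)w''(x)+c\int_0^Lw(t)\,dt=p(x),\quad x\in(0,L),\qquad w(0)=w(L)=w''(0)=w''(L)=0$$ has a corresponding solution $w=S\varphi\in W^{4,1}[0,L]$ (where $W^{4,1}[0,L]$ embeds compactly in $C^2[0,L]$). Moreover, this solution satisfies $$\|w\|_1\le\frac{2M-1}{M}\,\frac{L^2}{4a}\,\|p\|_1,\qquad \|w''\|_1\le\frac{N}{aM}\,2\|p\|_1 .$$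
   Context: $\|\cdot\|_1$ is the norm of $L^1[0,L]$. Differential equations are understood almost everywhere for functions in $W^{4,1}[0,L]$. Notation: $$M=1+c\Big(\frac{L^3}{12a}-\frac{L}{a^2}+\frac{2}{a^{5/2}}\tanh\frac{\sqrt aL}{2}\Big),\qquad N=1+c\Big(\frac{5L^3}{24a}-\frac{L}{a^2}+\frac{1}{a^{5/2}}\big(2-\tfrac{aL^2}{4}\big)\tanh\frac{\sqrt aL}{2}\Big).$$ Let $G:[0,L]^2\to\mathbb R$ be the Green function of $w\mapsto w''''-aw''$ with boundary conditions $w(0)=w(L)=w''(0)=w''(L)=0$, i.e. $G(x,s)=\frac{x(L-s)}{aL}-\frac{\sinh(\sqrt a x)\sinh(\sqrt a(L-s))}{a\sqrt a\sinh(\sqrt aL)}$ for $0\le x\le s\le L$, and $G(x,s)=G(s,x)$ for $s\le x$. For $\varphi\in L^1[0,L]$, the linear problem $w''''-aw''+c\int_0^Lw(t)\,dt=\varphi$ on $(0,L)$, $w(0)=w(L)=w''(0)=w''(L)=0$, has a unique solution $w=S\varphi\in W^{4,1}[0,L]$, given by $$(S\varphi)(x)=\int_0^LG(x,s)\varphi(s)\,ds-\frac{c\int_0^LG(x,s)\,ds}{1+c\int_0^L\int_0^LG(t,s)\,ds\,dt}\int_0^L\int_0^LG(t,s)\varphi(s)\,ds\,dt .$$ The operator $A:L^1[0,L]\to L^1[0,L]$ is defined by $$(A\varphi)(x)=p(x)+b\Big(\int_0^Lw(t)\,dt\Big)w''(x),\qquad w=S\varphi .$$ *)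

(* Defs.v *)
From mathcomp Require Import all_boot all_order all_algebra.
From mathcomp Require Import all_classical all_reals all_analysis.

Set Implicit Arguments.
Unset Strict Implicit.
Unset Printing Implicit Defensive.

Import Order.TTheory GRing.Theory Num.Theory.
Import numFieldNormedType.Exports.

Local Open Scope classical_set_scope.
Local Open Scope ring_scope.

Section hyperbolic.
Context {R : realType}.
Implicit Type x : R.

Definition sinh x : R := (expR x - expR (- x)) / 2.
Definition cosh x : R := (expR x + expR (- x)) / 2.
Definition tanh x : R := sinh x / cosh x.

End hyperbolic.

(* Functions on [0, L] are represented by functions R -> R of which only the
   values on [0, L] matter. *)

Section function_spaces.
Context {R : realType}.
Variable L : R.
Implicit Types (f g w : R -> R) (x : R).

Local Notation mu := (@lebesgue_measure R).

(* L^1[0, L] is handled through representatives; [L1eq] is equality in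
   L^1[0, L]. *)
Definition L1 f : Prop := mu.-integrable `[0, L] (EFin \o f).

Definition L1eq f g : Prop := ae_eq mu `[0, L]%classic f g.

(* [Rintegral] is 0 when the integral diverges, so this is the norm of L^1
   only for f in L1. *)
Definition L1norm f : R := \int[mu]_(x in `[0, L]) `|f x|.

Definition L1ball (r : R) f : Prop := L1 f /\ L1norm f <= r.

(* The derivative relative to [0, L]: two-sided in ]0, L[ and one-sided at the
   endpoints. [deriv L f x] has an arbitrary value if the limit does not
   exist. *)
Definition diff_quotient f x : R -> R := fun y => (f y - f x) / (y - x).

Definition has_deriv f x : Prop :=
  cvg (diff_quotient f x @ within `[0, L] x^').

Definition deriv f : R -> R :=
  fun x => lim (diff_quotient f x @ within `[0, L] x^').

Definition nderiv (k : nat) f : R -> R := iter k deriv f.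

(* C^k[0, L] *)
Definition Ck (k : nat) f : Prop :=
  (forall j, (j < k)%N -> forall x, x \in `[0, L] -> has_deriv (nderiv j f) x)
  /\ (forall j, (j <= k)%N -> {within `[0, L], continuous (nderiv j f)}).

Definition Cknorm (k : nat) f : R :=
  \sum_(j < k.+1) sup [set `|nderiv j f x| | x in `[0, L]].

Definition abs_cont f : Prop :=
  forall e : R, 0 < e -> exists2 d : R, 0 < d &
    forall (n : nat) (u v : 'I_n -> R),
      (forall i, [/\ 0 <= u i, u i <= v i & v i <= L]) ->
      trivIset setT (fun i => `]u i, v i[%classic) ->
      \sum_(i < n) (v i - u i) < d ->
      \sum_(i < n) `|f (v i) - f (u i)| < e.

(* W^{4,1}[0, L]: the functions of class C^3 on [0, L] whose third derivative is
   absolutely continuous. By Lebesgue's theorem the last clause is then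
   automatic; it records that the fourth derivative exists a.e. and is in L^1,
   and is stated up to a.e. equality because [nderiv 4 w] has junk values where
   the third derivative is not differentiable. *)
Definition W41 w : Prop :=
  [/\ Ck 3 w, abs_cont (nderiv 3 w)
    & exists2 g, L1 g &
        {ae mu, forall x, x \in `[0, L] ->
          has_deriv (nderiv 3 w) x /\ nderiv 4 w x = g x}].

Definition W41norm w : R := \sum_(j < 5) L1norm (nderiv j w).

(* Every sequence bounded in W^{4,1}[0, L] has a subsequence converging in
   C^2[0, L]. *)
Definition W41_compactly_embedded_in_C2 : Prop :=
  (forall w, W41 w -> Ck 2 w) /\
  forall (w_ : nat -> R -> R) (C : R),
    (forall n, W41 (w_ n) /\ W41norm (w_ n) <= C) ->
    exists (k : nat -> nat) (v : R -> R),
      [/\ {homo k : m n / (m < n)%N}, Ck 2 v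
        & Cknorm 2 (w_ (k n) \- v) @[n --> \oo] --> (0 : R)].

End function_spaces.

Section beam.
Context {R : realType}.
Variables L a b c : R.
Implicit Types (f w p phi : R -> R) (x s : R).

Local Notation mu := (@lebesgue_measure R).

Definition constM : R :=
  1 + c * (L ^+ 3 / (12 * a) - L / a ^+ 2
           + 2 / a `^ (5 / 2) * tanh (Num.sqrt a * L / 2)).

Definition constN : R :=
  1 + c * (5 * L ^+ 3 / (24 * a) - L / a ^+ 2
           + 1 / a `^ (5 / 2) * (2 - a * L ^+ 2 / 4)
             * tanh (Num.sqrt a * L / 2)).

Definition green_le x s : R :=
  x * (L - s) / (a * L)
  - sinh (Num.sqrt a * x) * sinh (Num.sqrt a * (L - s))
    / (a * Num.sqrt a * sinh (Num.sqrt a * L)).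

Definition green x s : R := if x <= s then green_le x s else green_le s x.

Definition integ f : R := \int[mu]_(x in `[0, L]) f x.

Definition solS phi : R -> R := fun x =>
  integ (fun s => green x s * phi s)
  - c * integ (fun s => green x s)
    / (1 + c * integ (fun t => integ (fun s => green t s)))
    * integ (fun t => integ (fun s => green t s * phi s)).

Definition opA p phi : R -> R := fun x =>
  p x + b * integ (solS phi) * nderiv L 2 (solS phi) x.

Definition beam_bvp p w : Prop :=
  {ae mu, forall x, x \in `]0, L[ ->
     nderiv L 4 w x - (a + b * integ w) * nderiv L 2 w x + c * integ w = p x}
  /\ [/\ w 0 = 0, w L = 0, nderiv L 2 w 0 = 0 & nderiv L 2 w L = 0].

End beam.

(* Main.v *)
(* Write r = sqrt a. The Green function is (K0 - Ka) / a, where K0 and Ka are the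
   Dirichlet kernels of - u'' and - u'' + a u. Since 0 <= K0 - Ka and Ka >= 0, the
   explicit integrals of the two kernels and Tonelli's theorem bound the mean of
   w = S phi by L^2 / (8 a M) |phi|_1 and w'' = - int Ka (phi - c int w) by
   N / (a M) |phi|_1. As A phi = p + b (int w) w'' is quadratic in phi, these two
   bounds make A a contraction of the ball of radius 2 |p|_1 exactly when the
   smallness condition on p holds. Since w'' is also bounded uniformly by |phi|_1,
   the Picard iterates minus p converge uniformly.

   For the compact embedding, an absolutely continuous third derivative
   oscillates by at most the L^1 norm of its derivative, so a bounded sequence of
   W^{4,1} has equi-Lipschitz derivatives up to order 2. *)

Require Import Defs.
From mathcomp Require Import all_boot all_order all_algebra.
From mathcomp Require Import all_classical all_reals all_analysis.
From mathcomp Require Import measurable_realfun ring lra.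
Import Order.TTheory GRing.Theory Num.Theory.
Import numFieldNormedType.Exports.
Local Open Scope classical_set_scope.
Local Open Scope ring_scope.
Set Implicit Arguments.
Unset Strict Implicit.
Unset Printing Implicit Defensive.


(** Derivatives in [W41] are limits relative to [0, L], one-sided at the endpoints, and the fourth
    exists only almost everywhere. They are handled through one local notion, [isD], and Cousin's
    lemma passes from local to global: for the mean value bound, for the constancy of an absolutely
    continuous function whose derivative vanishes almost everywhere, and for uniformity in the
    compactness argument. The obstacle to differentiating the Green potential is the diagonal. Both
    branches of the kernel are brought to one smooth expression plus a function of [x - s] cut off
    at [s <= x]. Such a Volterra term is differentiated under the integral as long as its kernel
    vanishes at 0. This lasts for three derivatives; the kernel reached, [cosh], has value 1 at 0
    and gives back the density, but only as the almost everywhere derivative of a primitive. The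
    nonlocal term is a number, so [S phi] is the Green potential of [phi] minus a constant; [M] is
    the factor that integrating the equation puts in front of the mean of [w], and [N] collects the
    response of w'' to [phi] and to that constant. *)

(** * Differentiation relative to a compact interval *)

Section one_sided_calculus.
Context {R : realType}.
Variable L : R.
Hypothesis L_gt0 : 0 < L.
Implicit Types (f g : R -> R) (x y l : R).

(* [f] has derivative [l] at [x] relative to [0, L], with the denominator of the
   difference quotient cleared. *)
Definition isD f x l := forall e, 0 < e -> exists2 d, 0 < d &
  forall y, 0 <= y <= L -> `|y - x| < d ->
    `|f y - f x - l * (y - x)| <= e * `|y - x|.

(** Properness makes the limit in [deriv] unique, also at the endpoints. A witness is found by
    moving from [x] towards the farther endpoint, by at most [L / 2]. *)
Lemma within_dnbhs_proper x : 0 <= x <= L ->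
  ProperFilter (within `[0, L] x^').
Proof.
move=> /andP[x0 xL]; split; last exact: within_filter.
rewrite /within /= => /nbhs_ballP[e /= e0 H].
have [xL2|xL2] := ltP x (L / 2).
  pose y := x + Num.min (e / 2) (L / 2).
  have m0 : 0 < Num.min (e / 2) (L / 2) by rewrite lt_min !divr_gt0.
  have m1 : Num.min (e / 2) (L / 2) <= e / 2 by rewrite ge_min lexx.
  have m2 : Num.min (e / 2) (L / 2) <= L / 2 by rewrite ge_min lexx orbT.
  apply: (H y); rewrite /ball/= /y ?in_itv/=.
  - rewrite opprD addNKr normrN gtr0_norm//; lra.
  - by rewrite gt_eqF// ltrDl.
  - apply/andP; split; lra.
pose y := x - Num.min (e / 2) (L / 2).
have m0 : 0 < Num.min (e / 2) (L / 2) by rewrite lt_min !divr_gt0.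
have m1 : Num.min (e / 2) (L / 2) <= e / 2 by rewrite ge_min lexx.
have m2 : Num.min (e / 2) (L / 2) <= L / 2 by rewrite ge_min lexx orbT.
apply: (H y); rewrite /ball/= /y ?in_itv/=.
- rewrite opprB addrC subrK gtr0_norm//; lra.
- by rewrite lt_eqF// ltrBlDr ltrDl.
- apply/andP; split; lra.
Qed.

Lemma isDP f x l : 0 <= x <= L ->
  diff_quotient f x y @[y --> within `[0, L] x^'] --> l <-> isD f x l.
Proof.
move=> xL; have PF := within_dnbhs_proper xL; split=> [/cvgrPdist_le H e e0|H].
  have := H _ e0; rewrite /within /= => /nbhs_ballP[d /= d0 Hd].
  exists d => // y yL yx; have [->|yNx] := eqVneq y x.
    by rewrite !subrr mulr0 subr0 normr0 mulr0.
  have := Hd y; rewrite /ball/= distrC => /(_ yx yNx).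
  rewrite in_itv/= => /(_ yL).
  have yx0 : 0 < `|y - x| by rewrite normr_gt0 subr_eq0.
  rewrite -(ler_pM2r yx0) -normrM mulrBl /diff_quotient divfK ?subr_eq0//.
  by rewrite distrC.
apply/cvgrPdist_le => e e0; have [d d0 Hd] := H e e0.
rewrite /within /=; apply/nbhs_ballP; exists d => //= y; rewrite /ball/= => yx yNx.
rewrite in_itv/= => yL; rewrite distrC in yx.
have yx0 : 0 < `|y - x| by rewrite normr_gt0 subr_eq0.
rewrite -(ler_pM2r yx0) -normrM mulrBl /diff_quotient divfK ?subr_eq0// distrC.
exact: Hd.
Qed.

Lemma isD_has_deriv f x l : 0 <= x <= L -> isD f x l -> has_deriv L f x.
Proof. by move=> xL /(isDP _ _ xL) H; apply/cvg_ex; exists l. Qed.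

Lemma isD_deriv f x l : 0 <= x <= L -> isD f x l -> Defs.deriv L f x = l.
Proof.
move=> xL /(isDP _ _ xL) H; have PF := within_dnbhs_proper xL.
by apply/cvg_lim => //; exact: Rhausdorff.
Qed.

Lemma has_deriv_isD f x : 0 <= x <= L -> has_deriv L f x ->
  isD f x (Defs.deriv L f x).
Proof. by move=> xL H; apply/(isDP _ _ xL). Qed.

Lemma isD_eq f g x l : 0 <= x <= L -> (forall y, 0 <= y <= L -> f y = g y) ->
  isD f x l -> isD g x l.
Proof.
move=> xL fg H e e0; have [d d0 Hd] := H e e0; exists d => // y yL yx.
by rewrite -!fg//; exact: Hd.
Qed.

Lemma isDD f g x l m : isD f x l -> isD g x m ->
  isD (fun y => f y + g y) x (l + m).
Proof.
move=> Hf Hg e e0; have e2 : 0 < e / 2 by rewrite divr_gt0.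
have [d d0 Hd] := Hf _ e2; have [d' d'0 Hd'] := Hg _ e2.
exists (Num.min d d') => [|y yL]; first by rewrite lt_min d0.
rewrite lt_min => /andP[yd yd'].
have -> : f y + g y - (f x + g x) - (l + m) * (y - x) =
  (f y - f x - l * (y - x)) + (g y - g x - m * (y - x)) by ring.
apply: le_trans (ler_normD _ _) _.
by apply: le_trans (lerD (Hd _ yL yd) (Hd' _ yL yd')) _; rewrite -mulrDl -splitr.
Qed.

Lemma isDZ f x k l : isD f x l -> isD (fun y => k * f y) x (k * l).
Proof.
move=> Hf e e0; have k0 : 0 < `|k| + 1 by rewrite ltr_wpDl.
have [d d0 Hd] := Hf (e / (`|k| + 1)) (divr_gt0 e0 k0).
exists d => // y yL yd.
have -> : k * f y - k * f x - k * l * (y - x) = k * (f y - f x - l * (y - x)).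
  by ring.
rewrite normrM; apply: le_trans (ler_wpM2l _ (Hd _ yL yd)) _ => //.
rewrite mulrA ler_wpM2r// mulrCA ger_pMr// ler_pdivrMr// mul1r lerDl//.
Qed.

Lemma isDB f g x l m : isD f x l -> isD g x m ->
  isD (fun y => f y - g y) x (l - m).
Proof.
move=> Hf /isDZ => /(_ (-1)) Hg; have := isDD Hf Hg; rewrite mulN1r.
by move=> H e /H [d d0 Hd]; exists d => // y yL yd; have := Hd y yL yd; rewrite !mulN1r.
Qed.

Lemma is_derive_isD f x l : is_derive x 1 f l -> isD f x l.
Proof.
move=> [df dfl] e e0.
have : h^-1 *: ((f \o shift x) (h *: 1) - f x) @[h --> 0^'] --> l.
  by rewrite -dfl; exact: df.
move=> /cvgrPdist_le/(_ e e0)/nbhs_ballP[d /= d0 Hd].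
exists d => // y _ yx; have [->|yNx] := eqVneq y x.
  by rewrite !subrr mulr0 subr0 normr0 mulr0.
have yx0 : y - x != 0 by rewrite subr_eq0.
have := Hd (y - x); rewrite /ball/= sub0r normrN => /(_ yx yx0).
have yx1 : 0 < `|y - x| by rewrite normr_gt0.
rewrite -(ler_pM2r yx1) -normrM mulrBl distrC.
by rewrite [_ *: 1]mulr1 subrK [_ *: (_ - _)]mulrC divfK.
Qed.

Lemma isD_lip f x l C : 0 <= C ->
  (forall y, 0 <= y <= L -> `|f y - f x - l * (y - x)| <= C * `|y - x| ^+ 2) ->
  isD f x l.
Proof.
move=> C0 H e e0; have C1 : 0 < C + 1 by rewrite ltr_wpDl.
exists (e / (C + 1)) => [|y yL yx]; first by rewrite divr_gt0.
apply: (le_trans (H y yL)); rewrite expr2 mulrA ler_wpM2r//.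
move: yx; rewrite ltr_pdivlMr// => /ltW; apply: le_trans.
by rewrite mulrC ler_wpM2l// lerDl.
Qed.

Lemma isD_continuous f : (forall x, 0 <= x <= L -> exists l, isD f x l) ->
  {within `[0, L], continuous f}.
Proof.
move=> H; apply/subspace_continuousP => x; rewrite /= in_itv/= => xL.
have [l Hl] := H x xL; apply/cvgrPdist_lt => e e0.
have [d d0 Hd] := Hl 1 ltr01.
have k0 : 0 < `|l| + 1 by rewrite ltr_wpDl.
rewrite /within /=; apply/nbhs_ballP.
exists (Num.min d (e / (`|l| + 1))) => /=; first by rewrite lt_min d0 divr_gt0.
move=> y; rewrite /ball/= lt_min distrC ltr_pdivlMr// => /andP[yd ye].
rewrite in_itv/= => yL; rewrite distrC; apply: le_lt_trans ye.
rewrite -(subrK (l * (y - x)) (f y - f x)).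
apply: (le_trans (ler_normD _ _)); rewrite normrM [leRHS]mulrDr mulr1 addrC.
by rewrite [`|y - x| * _]mulrC lerD2l; have := Hd y yL yd; rewrite mul1r.
Qed.

(* Cousin's lemma, for an interval predicate instead of tagged partitions. *)
Lemma cousin (P : R -> R -> Prop) :
  (forall u v w, 0 <= u -> u <= v -> v <= w -> w <= L -> P u v -> P v w -> P u w) ->
  (forall t, 0 <= t <= L -> exists2 d, 0 < d &
    forall u v, 0 <= u -> u <= t -> t <= v -> v <= L -> v - u < d -> P u v) ->
  forall x y, 0 <= x -> x <= y -> y <= L -> P x y.
Proof.
move=> Padd Ploc x y x0 xy yL.
pose A := [set z | x <= z <= y /\ P x z].
have xL : x <= L by exact: le_trans yL.
have Ax : A x.
  split; first by rewrite lexx.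
  by have [|d d0 Hd] := Ploc x; [rewrite x0|apply: Hd; rewrite ?subrr].
have ubA : has_sup A by split; [exists x|exists y => z [/andP[]]].
pose t := sup A.
have xt : x <= t by apply: ub_le_sup => //; case: ubA.
have ty : t <= y by apply: ge_sup; [exists x|move=> z [/andP[]]].
have [|d d0 Hd] := Ploc t; first by rewrite (le_trans x0 xt) (le_trans ty yL).
have [z [/andP[xz zy] Pxz] tz] := sup_adherent (divr_gt0 d0 (ltr0n _ 2)) ubA.
have zt : z <= t by apply: ub_le_sup => //; [case: ubA|split=> //; rewrite xz].
(* [P z v] holds because [z > t - d / 2] gives [v - z < d]. Hence [v] lies in [A], and [v <= t]
   forces [v = y]. *)
pose v := Num.min y (t + d / 4).
have tv : t <= v by rewrite le_min ty lerDl divr_ge0// ltW.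
have vy : v <= y by rewrite ge_min lexx.
have vt : v <= t + d / 4 by rewrite ge_min lexx orbT.
have Av : A v.
  split; first by rewrite vy (le_trans xt tv).
  apply: (Padd x z v) => //; rewrite ?(le_trans zt)// ?(le_trans vy)//.
  apply: Hd => //; rewrite ?(le_trans x0)// ?(le_trans vy)//.
  by move: tz; rewrite -/t; lra.
have vt' : v <= t by apply: ub_le_sup => //; case: ubA.
have : v = y; last by move=> <-; case: Av.
move: vt'; rewrite /v; case: (leP y (t + d / 4)) => // _; lra.
Qed.

(** Around each point the slope is at most [C] plus a slack [e / (L + 1)]. This inequality adds up
    over adjacent intervals, so Cousin's lemma makes it global, and the total slack is at most
    [e]. *)
Lemma isD_bound f f' C x y : 0 <= C -> 0 <= x -> x <= y -> y <= L ->
  (forall t, 0 <= t <= L -> isD f t (f' t)) ->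
  (forall t, x <= t <= y -> `|f' t| <= C) ->
  `|f y - f x| <= C * (y - x).
Proof.
move=> C0 x0 xy yL fD f'C; apply/ler_addgt0Pl => e e0.
have e'0 : 0 < e / (L + 1) by rewrite divr_gt0// ltr_wpDl// ltW.
have : `|f y - f x| <= (e / (L + 1) + C) * (y - x).
  refine (@cousin (fun u v => x <= u -> v <= y ->
    `|f v - f u| <= (e / (L + 1) + C) * (v - u)) _ _ x y x0 xy yL (lexx _) (lexx _)).
    move=> u v w _ uv vw _ H1 H2 xu wy; rewrite -(subrK (f v) (f w)) -addrA.
    apply: (le_trans (ler_normD _ _)).
    have := lerD (H2 (le_trans xu uv) wy) (H1 xu (le_trans vw wy)).
    by move=> /le_trans; apply; lra.
  move=> t tL; have [d d0 Hd] := fD t tL _ e'0; exists d => //.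
  move=> u v u0 ut tv vL vu xu vy.
  have Hb z : 0 <= z <= L -> `|z - t| < d ->
      `|f z - f t| <= (e / (L + 1) + C) * `|z - t|.
    move=> zL zt; rewrite -(subrK (f' t * (z - t)) (f z - f t)).
    apply: (le_trans (ler_normD _ _)); rewrite mulrDl lerD ?Hd//.
    by rewrite normrM ler_wpM2r// f'C// (le_trans xu ut) (le_trans tv vy).
  move: tL => /andP[t0 tL].
  rewrite -(subrK (f t) (f v)) -addrA; apply: (le_trans (ler_normD _ _)).
  have -> : v - u = (v - t) + (t - u) by ring.
  have vt0 : `|v - t| = v - t by rewrite ger0_norm// subr_ge0.
  have ut0 : `|u - t| = t - u by rewrite distrC ger0_norm// subr_ge0.
  rewrite mulrDr lerD//.
    by have := Hb v; rewrite vt0; apply; [rewrite (le_trans t0 tv) vL|lra].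
  have := Hb u; rewrite ut0 distrC; apply; [by rewrite u0 (le_trans ut tL)|lra].
move=> /le_trans; apply; rewrite mulrDl lerD2r.
rewrite mulrAC ler_pdivrMr ?ltr_wpDl// ?(ltW L_gt0)// ler_wpM2l// ?ltW//.
lra.
Qed.

Lemma isD_lipschitz f f' C : 0 <= C ->
  (forall x, 0 <= x <= L -> isD f x (f' x)) ->
  (forall x, 0 <= x <= L -> `|f' x| <= C) ->
  forall x y, 0 <= x <= L -> 0 <= y <= L -> `|f y - f x| <= C * `|y - x|.
Proof.
move=> C0 fD f'C x y; wlog xy : x y / x <= y => [H|] /andP[x0 xL] /andP[y0 yL].
  have [xy|/ltW yx] := leP x y; last rewrite distrC (distrC y);
    by apply: H; rewrite // ?x0 ?y0.
rewrite (ger0_norm (x := y - x)) ?subr_ge0//; apply: (isD_bound C0 x0 xy yL fD).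
by move=> t /andP[xt ty]; apply: f'C; rewrite (le_trans x0 xt) (le_trans ty yL).
Qed.

(** The mean value bound for [f] minus the line of slope [f' x], whose derivative between the two
    points is at most [C * |y - x|]. The remainder depends on [f] only through [C], which lets it
    pass to limits of sequences. *)
Lemma isD_taylor f f' C : 0 <= C ->
  (forall x, 0 <= x <= L -> isD f x (f' x)) ->
  (forall x y, 0 <= x <= L -> 0 <= y <= L -> `|f' y - f' x| <= C * `|y - x|) ->
  forall x y, 0 <= x <= L -> 0 <= y <= L ->
    `|f y - f x - f' x * (y - x)| <= C * `|y - x| ^+ 2.
Proof.
move=> C0 fD f'C x y /andP[x0 xL] /andP[y0 yL].
have lin t : isD (fun z => f' x * z) t (f' x).
  apply: (@isD_lip _ _ _ 0) => // z _.
  by rewrite mul0r -mulrBr subrr normr0.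
have gD t : 0 <= t <= L -> isD (fun z => f z - f' x * z) t (f' t - f' x).
  by move=> tL; apply: isDB; [exact: fD|exact: lin].
have E : f y - f x - f' x * (y - x) = f y - f' x * y - (f x - f' x * x) by ring.
have C' : 0 <= C * `|y - x| by rewrite mulr_ge0.
rewrite E expr2 mulrA; have [xy|/ltW yx] := leP x y.
  have {2}-> : `|y - x| = y - x by rewrite ger0_norm// subr_ge0.
  apply: (isD_bound C' x0 xy yL gD) => t /andP[xt ty].
  apply: le_trans (f'C _ _ _ _) _;
    rewrite ?x0 ?xL ?(le_trans x0 xt) ?(le_trans ty yL)// ler_wpM2l//.
  by rewrite !ger0_norm ?subr_ge0// lerB.
rewrite distrC; have {2}-> : `|y - x| = x - y by rewrite distrC ger0_norm// subr_ge0.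
apply: (isD_bound C' y0 yx xL gD) => t /andP[yt tx].
apply: le_trans (f'C _ _ _ _) _;
  rewrite ?x0 ?xL ?(le_trans y0 yt) ?(le_trans tx xL)// ler_wpM2l//.
by rewrite distrC (distrC y) !ger0_norm ?subr_ge0// lerB.
Qed.

(** Since [deriv] looks only at values on [0, L], an identification of the derivatives there
    survives the iteration. Explicit candidates [d j] thus replace iterated limits. *)
Lemma isD_chain_nderiv (n : nat) (w : R -> R) (d : nat -> R -> R) :
  (forall x, 0 <= x <= L -> w x = d 0%N x) ->
  (forall j x, (j < n)%N -> 0 <= x <= L -> isD (d j) x (d j.+1 x)) ->
  forall j x, (j <= n)%N -> 0 <= x <= L -> nderiv L j w x = d j x.
Proof.
move=> wd dD; elim => [|j IH] x jn xL; first exact: wd.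
apply: isD_deriv => //; apply: (isD_eq xL (f := d j)); last exact: dD.
by move=> y yL; apply/esym/IH => //; exact: ltnW.
Qed.

Lemma isD_chain_Ck (n : nat) (w : R -> R) (d : nat -> R -> R) :
  (forall x, 0 <= x <= L -> w x = d 0%N x) ->
  (forall j x, (j < n)%N -> 0 <= x <= L -> isD (d j) x (d j.+1 x)) ->
  {within `[0, L], continuous (d n)} ->
  Ck L n w.
Proof.
move=> wd dD dc; have E := isD_chain_nderiv wd dD.
have nD j x : (j < n)%N -> 0 <= x <= L -> isD (nderiv L j w) x (d j.+1 x).
  move=> jn xL; apply: (isD_eq xL (f := d j)); last exact: dD.
  by move=> y yL; apply/esym/E => //; exact: ltnW.
split=> j jn.
  by move=> x; rewrite in_itv/= => xL; apply: isD_has_deriv (nD j x jn xL).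
move: jn; rewrite leq_eqVlt => /predU1P[->|jn]; last first.
  by apply: isD_continuous => x xL; exists (d j.+1 x); exact: nD.
apply: subspace_eq_continuous dc => x /set_mem /=.
by rewrite in_itv/= => xL; apply/esym/E.
Qed.

End one_sided_calculus.

(** * Absolutely continuous functions *)

Section absolute_continuity.
Context {R : realType}.
Variable L : R.
Hypothesis L_gt0 : 0 < L.
Implicit Types (f g : R -> R).
Local Notation mu := (@lebesgue_measure R).

(** The Cousin argument concatenates families of intervals, which suits ordered lists better than
    families indexed by ordinals; the order of the list gives the disjointness. *)
Lemma abs_cont_seq f (e d : R) (s : seq (R * R)) : 
  (forall (n : nat) (u v : 'I_n -> R),
      (forall i, [/\ 0 <= u i, u i <= v i & v i <= L]) ->
      trivIset setT (fun i => `]u i, v i[%classic) ->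
      \sum_(i < n) (v i - u i) < d ->
      \sum_(i < n) `|f (v i) - f (u i)| < e) ->
  all (fun i => [&& 0 <= i.1, i.1 <= i.2 & i.2 <= L]) s ->
  pairwise (fun i j => i.2 <= j.1) s ->
  \sum_(i <- s) (i.2 - i.1) < d -> \sum_(i <- s) `|f i.2 - f i.1| < e.
Proof.
move=> H /allP sL sp; rewrite !(big_nth (0, 0)) !big_mkord => sd.
pose u (i : 'I_(size s)) := (nth (0, 0) s i).1.
pose v (i : 'I_(size s)) := (nth (0, 0) s i).2.
apply: (H (size s) u v _ _ sd).
  by move=> i; have /sL/and3P[] := mem_nth (0, 0) (ltn_ord i).
apply/trivIsetP => i j _ _; wlog ij : i j / (i < j)%N.
  move=> W iNj; case: (ltngtP i j) => [ij|ji|/val_inj ij].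
  - exact: W.
  - by rewrite setIC; apply: W; rewrite // eq_sym.
  - by rewrite ij eqxx in iNj.
move=> _; rewrite -subset0 => z [] /=; rewrite !in_itv/= => /andP[_ zi] /andP[jz _].
have := sp; move/(pairwiseP (0, 0))/(_ i j (ltn_ord i) (ltn_ord j) ij) => ij'.
by have := lt_trans zi (le_lt_trans ij' jz); rewrite ltxx.
Qed.

(* Cousin's lemma, with the interval [u, v] carrying a family of disjoint
   subintervals of a small open neighbourhood of the exceptional null set. *)
Lemma abs_cont_isD0_cst f : abs_cont L f ->
  {ae mu, forall x, x \in `[0, L] -> isD L f x 0} ->
  forall x y, 0 <= x <= L -> 0 <= y <= L -> f x = f y.
Proof.
move=> fac [N [mN N0 subN]].
suff H x y : 0 <= x -> x <= y -> y <= L -> f x = f y.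
  move=> x y /andP[x0 xL] /andP[y0 yL]; have [xy|/ltW yx] := leP x y.
    exact: H.
  by apply/esym; exact: H.
move=> x0 xy yL; apply/esym/eqP; rewrite -subr_eq0 -normr_le0.
apply/ler_addgt0Pl => e0 e00; rewrite addr0.
pose e := e0 / (L + 1).
have L1 : 0 < L + 1 by rewrite ltr_wpDl// ltW.
have e_gt0 : 0 < e by rewrite divr_gt0.
have [d d0 Hd] := fac e e_gt0.
have [|U [oU NU Ud]] := @lebesgue_regularity_outer R N d mN _ d0.
  by move: N0 => /= ->; rewrite ltry.
have mU : measurable U by exact: measurable_realfun.open_measurable.
have {}Ud : (mu U < d%:E)%E.
  suff -> : mu U = mu (U `\` N) by [].
  rewrite -(setDUK NU) measureU//; first by move: N0 => /= ->; rewrite add0e setDUK.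
    exact: measurableD.
  by rewrite setDIK.
(* An increment of [f] is charged to the length of [[u, v]] at slope [e], or to the intervals of
   [s], whose total length is paid for by the measure of [U]. Intervals open on the left make that
   measure additive. *)
pose P u v := exists s : seq (R * R), [/\
  all (fun i => [&& u <= i.1, i.1 <= i.2 & i.2 <= v]) s,
  pairwise (fun i j => i.2 <= j.1) s,
  ((\sum_(i <- s) (i.2 - i.1))%:E <= mu (U `&` `]u, v]))%E
  & `|f v - f u| <= e * (v - u) + \sum_(i <- s) `|f i.2 - f i.1| ].
have [s [sL sp sU fs]] : P x y.
  apply: (@cousin R L) => //.
  - move=> u v w u0 uv vw wL [s [s1 s2 s3 s4]] [t [t1 t2 t3 t4]].
    exists (s ++ t); split.
    + rewrite all_cat; apply/andP; split.
        by apply: sub_all s1 => i /and3P[-> -> /=]/le_trans; exact.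
      by apply: sub_all t1 => i /and3P[+ -> ->]; rewrite !andbT; exact: le_trans.
    + rewrite pairwise_cat s2 t2 !andbT; apply/allrelP => i j si tj.
      move/allP : s1 => /(_ _ si)/and3P[_ _ iv].
      by move/allP : t1 => /(_ _ tj)/and3P[+ _ _]; exact: le_trans.
    + rewrite big_cat/= EFinD.
      have -> : U `&` `]u, w] = (U `&` `]u, v]) `|` (U `&` `]v, w]).
        by rewrite -setIUr -itv_bndbnd_setU// bnd_simp.
      rewrite measureU ?leeD//; [exact: measurableI|exact: measurableI|].
      rewrite -subset0 => z [[_ /=]]; rewrite in_itv/= => /andP[_ zv] [_ /=].
      by rewrite in_itv/= => /andP[]; rewrite ltNge zv.
    + rewrite big_cat/= -(subrK (f v) (f w)) -addrA (le_trans (ler_normD _ _))//.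
      by rewrite (le_trans (lerD t4 s4))//; lra.
  - move=> t tL; have [Nt|NNt] := pselect (N t).
      have /NU Ut := Nt.
      have /nbhs_ballP[r /= r0 rU] : nbhs t U by exact: open_nbhs_nbhs.
      exists r => // u v u0 ut tv vL vu; exists [:: (u, v)]; split => //.
      + by rewrite /= !lexx (le_trans ut tv).
      + rewrite big_seq1/= setIidr; last first.
          move=> z /=; rewrite in_itv/= => /andP[uz zv]; apply: rU.
          by rewrite /ball/= ltr_norml; apply/andP; split; lra.
        rewrite lebesgue_measure_itv/= lte_fin; case: ltP => // vu'.
        by rewrite lee_fin subr_le0.
      + by rewrite big_seq1/= lerDr mulr_ge0 ?(ltW e_gt0)// subr_ge0 (le_trans ut).
    have tD : isD L f t 0.
      by apply: contrapT => /= tD; apply: NNt; apply: subN => /= H; apply/tD/H;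
        rewrite in_itv.
    have [r r0 Hr] := tD e e_gt0.
    exists r => // u v u0 ut tv vL vu; exists [::]; split => //.
      by rewrite big_nil measure_ge0.
    rewrite big_nil addr0 -(subrK (f t) (f v)) -addrA.
    move: tL => /andP[t0 tL].
    have -> : v - u = (v - t) + (t - u) by ring.
    have vt0 : `|v - t| = v - t by rewrite ger0_norm// subr_ge0.
    have ut0 : `|u - t| = t - u by rewrite distrC ger0_norm// subr_ge0.
    rewrite mulrDr (le_trans (ler_normD _ _))// lerD//.
      have := Hr v; rewrite vt0 mul0r subr0.
      by apply; [rewrite (le_trans t0 tv) vL|lra].
    have := Hr u; rewrite ut0 mul0r subr0 distrC; apply; last by lra.
    by rewrite u0 (le_trans ut tL).
have sL' : all (fun i => [&& 0 <= i.1, i.1 <= i.2 & i.2 <= L]) s.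
  apply: sub_all sL => i /and3P[xi -> iy].
  by rewrite (le_trans x0 xi) (le_trans iy yL).
have sd : \sum_(i <- s) (i.2 - i.1) < d.
  rewrite -lte_fin (le_lt_trans sU)// (le_lt_trans _ Ud)//.
  by rewrite le_measure// ?inE//; exact: measurableI.
have /ltW := abs_cont_seq Hd sL' sp sd.
move=> se; rewrite (le_trans fs)// (le_trans (lerD (lexx _) se))//.
have -> : e0 = e * L + e by rewrite /e; field; rewrite gt_eqF.
by rewrite lerD2r ler_wpM2l ?(ltW e_gt0)//; lra.
Qed.

Lemma abs_contB f g : abs_cont L f -> abs_cont L g ->
  abs_cont L (fun x => f x - g x).
Proof.
move=> fac gac e e0; have e2 : 0 < e / 2 by rewrite divr_gt0.
have [d d0 Hd] := fac _ e2; have [d' d'0 Hd'] := gac _ e2.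
exists (Num.min d d') => [|n u v uv tuv]; first by rewrite lt_min d0.
rewrite lt_min => /andP[sd sd'].
apply: (@le_lt_trans _ _ (\sum_(i < n) `|f (v i) - f (u i)| +
    \sum_(i < n) `|g (v i) - g (u i)|)); last first.
  by rewrite (splitr e) ltrD// ?Hd ?Hd'.
rewrite -big_split/=; apply: ler_sum => i _.
have -> : f (v i) - g (v i) - (f (u i) - g (u i)) =
  (f (v i) - f (u i)) - (g (v i) - g (u i)) by ring.
exact: ler_normB.
Qed.

Lemma abs_contD f g : abs_cont L f -> abs_cont L g ->
  abs_cont L (fun x => f x + g x).
Proof.
move=> fac gac e e0; have e2 : 0 < e / 2 by rewrite divr_gt0.
have [d d0 Hd] := fac _ e2; have [d' d'0 Hd'] := gac _ e2.
exists (Num.min d d') => [|n u v uv tuv]; first by rewrite lt_min d0.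
rewrite lt_min => /andP[sd sd'].
apply: (@le_lt_trans _ _ (\sum_(i < n) `|f (v i) - f (u i)| +
    \sum_(i < n) `|g (v i) - g (u i)|)); last first.
  by rewrite (splitr e) ltrD// ?Hd ?Hd'.
rewrite -big_split/=; apply: ler_sum => i _.
have -> : f (v i) + g (v i) - (f (u i) + g (u i)) =
  (f (v i) - f (u i)) + (g (v i) - g (u i)) by ring.
exact: ler_normD.
Qed.

Lemma lipschitz_abs_cont f (C : R) : 0 <= C ->
  (forall x y, 0 <= x <= L -> 0 <= y <= L -> `|f y - f x| <= C * `|y - x|) ->
  abs_cont L f.
Proof.
move=> C0 H e e0; have C1 : 0 < C + 1 by rewrite ltr_wpDl.
exists (e / (C + 1)) => [|n u v uv _]; first by rewrite divr_gt0.
rewrite ltr_pdivlMr// mulrC; apply: le_lt_trans.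
rewrite mulr_sumr; apply: ler_sum => i _; have [u0 uv1 vL] := uv i.
apply: le_trans (H _ _ _ _) _; rewrite ?u0 ?vL ?(le_trans u0) ?(le_trans uv1)//.
rewrite ger0_norm ?subr_ge0// ler_wpM2r// ?subr_ge0// lerDl//.
Qed.

Lemma abs_cont_continuous f : abs_cont L f -> {within `[0, L], continuous f}.
Proof.
move=> fac; apply/subspace_continuousP => x; rewrite /= in_itv/= => xL.
apply/cvgrPdist_lt => e e0; have [d d0 Hd] := fac e e0.
rewrite /within /=; apply/nbhs_ballP; exists d => //= y; rewrite /ball/= => xy.
rewrite in_itv/= => yL; have t1 (A : 'I_1 -> set R) : trivIset setT A.
  by move=> i j _ _ _; rewrite (ord1 i) (ord1 j).
move: xL yL => /andP[x0 xL] /andP[y0 yL]; have [xley|/ltW yx] := leP x y.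
  have := Hd 1%N (fun=> x) (fun=> y); rewrite !big_ord1 distrC; apply => //.
  by rewrite -(ger0_norm (x := y - x)) ?subr_ge0// distrC.
have := Hd 1%N (fun=> y) (fun=> x); rewrite !big_ord1; apply => //.
by rewrite -(ger0_norm (x := x - y)) ?subr_ge0.
Qed.

End absolute_continuity.

(** * Integrable functions on [0, L] *)

Section L1_space.
Context {R : realType}.
Variable L : R.
Hypothesis L_gt0 : 0 < L.
Implicit Types (f g k : R -> R).
Local Notation mu := (@lebesgue_measure R).

Lemma L1norm_ge0 f : 0 <= L1norm L f.
Proof. exact: Rintegral_ge0. Qed.

Lemma continuous_L1 f : {within `[0, L], continuous f} -> L1 L f.
Proof. by move=> fc; apply: continuous_compact_integrable => //; exact: segment_compact. Qed.

Lemma L1_cst (r : R) : L1 L (fun=> r).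
Proof. by apply: continuous_L1; apply: continuous_subspaceT => ?; exact: cvg_cst. Qed.

Lemma L1_norm f : L1 L f -> L1 L (fun x => `|f x|).
Proof. by move=> fL; exact: (integrable_abse fL). Qed.

Lemma L1_eq f g : (forall x, 0 <= x <= L -> f x = g x) -> L1 L f -> L1 L g.
Proof.
move=> fg; apply: eq_integrable => // x /set_mem /=.
by rewrite in_itv/= => xL; rewrite fg.
Qed.

Lemma L1D f g : L1 L f -> L1 L g -> L1 L (fun x => f x + g x).
Proof.
move=> fL gL.
have : mu.-integrable `[0, L] ((EFin \o f) \+ (EFin \o g))%E by exact: integrableD.
exact: eq_integrable.
Qed.

Lemma L1Z (r : R) f : L1 L f -> L1 L (fun x => r * f x).
Proof.
move=> fL.
have : mu.-integrable `[0, L] (fun x => r%:E * (EFin \o f) x)%E by exact: integrableZl.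
exact: eq_integrable.
Qed.

Lemma L1B f g : L1 L f -> L1 L g -> L1 L (fun x => f x - g x).
Proof.
move=> fL gL; apply: (@L1_eq (fun x => f x + (-1) * g x)) => [x _|].
  by rewrite mulN1r.
by apply: L1D => //; exact: L1Z.
Qed.

Lemma L1_measurable f : L1 L f -> measurable_fun `[0, L] f.
Proof. by case/integrableP => /measurable_EFinP. Qed.

Lemma L1_bounded_mul k f C : measurable_fun `[0, L] k ->
  (forall x, 0 <= x <= L -> `|k x| <= C) -> L1 L f -> L1 L (fun x => k x * f x).
Proof.
move=> mk kC fL; apply: le_integrable (L1Z C (L1_norm fL)) => //.
  by apply/measurable_EFinP/measurable_funM => //; exact: L1_measurable.
move=> x /=; rewrite in_itv/= => xL; rewrite lee_fin !normrM normr_id.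
by rewrite ler_wpM2r// (le_trans (kC x xL))// ler_norm.
Qed.

Lemma integ_eq f g : (forall x, 0 <= x <= L -> f x = g x) ->
  integ L f = integ L g.
Proof.
move=> fg; apply: eq_Rintegral => x /set_mem /=.
by rewrite in_itv/= => xL; rewrite fg.
Qed.

Lemma integD f g : L1 L f -> L1 L g ->
  integ L (fun x => f x + g x) = integ L f + integ L g.
Proof. by move=> fL gL; exact: RintegralD. Qed.

Lemma integB f g : L1 L f -> L1 L g ->
  integ L (fun x => f x - g x) = integ L f - integ L g.
Proof. by move=> fL gL; exact: RintegralB. Qed.

Lemma integZ (r : R) f : L1 L f -> integ L (fun x => r * f x) = r * integ L f.
Proof. by move=> fL; exact: RintegralZl. Qed.

Lemma integ_cst (r : R) : integ L (fun=> r) = r * L.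
Proof.
have mI : fine (mu `[0, L]) = L.
  by rewrite lebesgue_measure_itv/= lte_fin L_gt0/= subr0.
by rewrite /integ Rintegral_cst//; congr (_ * _); exact: mI.
Qed.

Lemma le_integ f g : L1 L f -> L1 L g ->
  (forall x, 0 <= x <= L -> f x <= g x) -> integ L f <= integ L g.
Proof.
by move=> fL gL fg; apply: le_Rintegral => // x /=; rewrite in_itv/=; exact: fg.
Qed.

Lemma normr_integ f : L1 L f -> `|integ L f| <= L1norm L f.
Proof. by move=> fL; exact: le_normr_Rintegral. Qed.

Lemma le_L1norm f g : L1 L f -> L1 L g ->
  (forall x, 0 <= x <= L -> `|f x| <= g x) -> L1norm L f <= integ L g.
Proof. by move=> fL gL; apply: le_integ => //; exact: L1_norm. Qed.

Lemma L1normD f g : L1 L f -> L1 L g ->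
  L1norm L (fun x => f x + g x) <= L1norm L f + L1norm L g.
Proof.
move=> fL gL; rewrite -[leRHS]integD; [|exact: L1_norm|exact: L1_norm].
apply: le_L1norm => [||x _]; first exact: L1D; last exact: ler_normD.
by apply: L1D; exact: L1_norm.
Qed.

Lemma L1normZ (r : R) f : L1 L f -> L1norm L (fun x => r * f x) = `|r| * L1norm L f.
Proof.
move=> fL; rewrite -[RHS]integZ; last exact: L1_norm.
by apply: integ_eq => x _; rewrite normrM.
Qed.

Lemma L1normB f g : L1 L f -> L1 L g ->
  L1norm L (fun x => f x - g x) <= L1norm L f + L1norm L g.
Proof.
move=> fL gL; rewrite -[leRHS]integD; [|exact: L1_norm|exact: L1_norm].
apply: le_L1norm => [||x _]; first exact: L1B; last exact: ler_normB.
by apply: L1D; exact: L1_norm.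
Qed.

Lemma L1norm_eq f g : (forall x, 0 <= x <= L -> f x = g x) ->
  L1norm L f = L1norm L g.
Proof. by move=> fg; apply: integ_eq => x xL; rewrite fg. Qed.

End L1_space.

(** * Primitives of integrable functions *)

Section primitives.
Context {R : realType}.
Variable L : R.
Hypothesis L_gt0 : 0 < L.
Implicit Types (f g : R -> R).
Local Notation mu := (@lebesgue_measure R).

Definition primitive g x : R := \int[mu]_(t in `[0, x]) g t.

Lemma L1_restrict g : L1 L g -> mu.-integrable setT (EFin \o (g \_ `[0, L])).
Proof.
by move=> gL; rewrite -restrict_EFin; apply/integrable_restrict => //=; rewrite setTI.
Qed.

Lemma primitiveB g x y : L1 L g -> 0 <= x -> x <= y -> y <= L ->
  primitive g y - primitive g x = \int[mu]_(t in `]x, y]) g t.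
Proof.
move=> gL x0 xy yL; apply: Rintegral_itvB; rewrite ?bnd_simp//.
by apply: integrableS gL => //; apply: subset_itvl; rewrite bnd_simp.
Qed.

(** The open interval matches those of [abs_cont], and the restriction of [g] is integrable over the
    whole line, where the absolute continuity of the integral is applied. *)
Lemma primitiveB_le g x y : L1 L g -> 0 <= x -> x <= y -> y <= L ->
  `|primitive g y - primitive g x| <=
     \int[mu]_(t in `]x, y[) `|(g \_ `[0, L]) t|.
Proof.
move=> gL x0 xy yL; rewrite primitiveB//.
have s1 : `]x, y] `<=` `[0, L].
  by move=> z /=; rewrite !in_itv/= => /andP[/ltW xz zy]; rewrite (le_trans x0) ?(le_trans zy).
have i1 : mu.-integrable `]x, y] (EFin \o g) by exact: integrableS gL.
have i2 : mu.-integrable `]x, y] (EFin \o (fun t => `|g t|)).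
  exact: (integrable_abse i1).
rewrite (le_trans (le_normr_Rintegral _ i1))// -Rintegral_itv_bndo_bndc; last first.
  by apply: integrableS i2 => //; apply: subset_itvl; rewrite bnd_simp.
rewrite le_eqVlt; apply/orP; left; apply/eqP; apply: eq_Rintegral => t /set_mem /= txy.
rewrite patchE ifT// inE/=; apply: s1; move: txy; rewrite /= !in_itv/=.
by move=> /andP[-> /ltW].
Qed.

Lemma primitiveB_le_L1norm g x y : L1 L g -> 0 <= x <= L -> 0 <= y <= L ->
  `|primitive g y - primitive g x| <= L1norm L g.
Proof.
move=> gL; wlog xy : x y / x <= y => [H|] /andP[x0 xL] /andP[y0 yL].
  by have [|/ltW yx] := leP x y => [xy|]; [|rewrite distrC]; apply: H;
    rewrite // ?x0 ?y0.
apply: (le_trans (primitiveB_le gL x0 xy yL)).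
have iabs : mu.-integrable `[0, L] (EFin \o (fun t => `|(g \_ `[0, L]) t|)).
  have /integrable_abse := L1_restrict gL.
  by apply: integrableS.
have -> : L1norm L g = \int[mu]_(t in `[0, L]) `|(g \_ `[0, L]) t|.
  by apply: eq_Rintegral => t tL; rewrite patchE tL.
rewrite /Rintegral fine_le//.
- apply: integrable_fin_num => //.
  by apply: integrableS iabs => //; apply: subset_itvScc; rewrite bnd_simp.
- exact: integrable_fin_num.
apply: ge0_subset_integral => //=.
- by case/integrableP : iabs.
- by apply: subset_itvScc; rewrite bnd_simp.
Qed.

Lemma primitive_abs_cont g : L1 L g -> abs_cont L (primitive g).
Proof.
move=> gL e e0; have gT := L1_restrict gL.
have [d [d0 Hd]] := integral_normr_continuous gT e0.
exists d => // n u v uv tuv sd.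
pose F i := `]u i, v i[%classic.
have tF : trivIset [set` index_enum 'I_n] F by exact: sub_trivIset tuv.
have uF : uniq (index_enum 'I_n) by exact: index_enum_uniq.
have mF i : measurable (F i) by exact: measurable_itv.
have muF i : mu `]u i, v i[ = (v i - u i)%:E.
  rewrite lebesgue_measure_itv/= lte_fin; case: ltP => // vu.
  have [_ uv' _] := uv i; have -> : u i = v i by apply/eqP; rewrite eq_le uv'.
  by rewrite subrr.
have mD : measurable (\big[setU/set0]_(i <- index_enum 'I_n) F i).
  exact: bigsetU_measurable.
have : (mu (\big[setU/set0]_(i <- index_enum 'I_n) F i) < d%:E)%E.
  rewrite -[X in (X < _)%E]mul1e -integral_cst//.
  rewrite (ge0_integral_bigsetU mu mF uF tF)//.
  rewrite (_ : (\sum_(_ <- _) _)%R = (\sum_(i < n) (v i - u i))%:E) ?lte_fin//.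
  rewrite -sumEFin; apply: eq_bigr => i _.
  by rewrite integral_cst; [rewrite mul1e; exact: muF|exact: mF].
move=> /(Hd _ mD) H; apply: le_lt_trans H.
have mg : measurable_fun setT (fun x => `|(g \_ `[0, L]) x|).
  by apply: measurableT_comp => //; case/integrableP : gT => /measurable_EFinP.
rewrite [leRHS]/Rintegral (integral_bigsetU_EFin mu mF uF tF); last first.
  by apply/measurable_EFinP; exact: measurable_funTS.
have iabs i : mu.-integrable `]u i, v i[ (EFin \o (fun t => `|(g \_ `[0, L]) t|)).
  have /integrable_abse H := gT.
  by apply: integrableS H.
rewrite (eq_bigr (fun i => (\int[mu]_(t in `]u i, v i[) `|(g \_ `[0, L]) t|)%:E));
  last by move=> i _; rewrite fineK//; exact: integrable_fin_num.
rewrite sumEFin/=.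
by apply: ler_sum => i _; have [u0 uv' vL] := uv i; exact: primitiveB_le.
Qed.

Lemma primitive_isD_ae g : L1 L g ->
  {ae mu, forall x, x \in `[0, L] -> isD L (primitive g) x (g x)}.
Proof.
move=> gL; have gT := L1_restrict gL.
have gi y : mu.-integrable `[0, y] (EFin \o (g \_ `[0, L])).
  by apply: integrableS gT.
have gloc : locally_integrable setT (g \_ `[0, L]) by exact: integrable_locally_restrict.
have H0 := FTC1 gi gloc; cbv zeta in H0.
(* The differentiation theorem concerns points strictly to the right of 0, so the point 0 joins the
   null set. *)
have N0 : {ae mu, forall x : R, x != 0}.
  exists [set 0]; split => //; first exact: lebesgue_measure_set1.
  by move=> x /= /negP; rewrite negbK => /eqP.
have FF := ae_filter_ringOfSetsType mu.
apply: (@filterS2 _ _ FF _ _ _ _ H0 N0) => x H x0 xL.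
have xL' : 0 <= x <= L by move: xL; rewrite in_itv.
have [|] := H; first by rewrite lte_fin lt_neqAle eq_sym x0; case/andP : xL'.
rewrite patchE mem_set//= derive1E => dF Fx.
apply: (isD_eq xL' (f := fun y => \int[mu]_(t in `[0, y]) (g \_ `[0, L]) t)).
  move=> y /andP[y0 yL]; apply: eq_Rintegral => t /set_mem /=.
  rewrite patchE in_itv/= => /andP[t0 ty]; rewrite ifT// inE/= in_itv/= t0.
  exact: le_trans yL.
by apply: is_derive_isD; split.
Qed.

End primitives.

Import HBNNSimple.

(* [ae_eq_integral] without measurability of the first function: [L1norm] is
   applied to the fourth derivative, which has junk values on a null set. *)
Lemma ge0_ae_eq_integral d (T : measurableType d) (R : realType)
    (mu : {measure set T -> \bar R}) (D : set T) (f g : T -> \bar R) :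
  measurable D -> (forall x, (0 <= f x)%E) -> (forall x, (0 <= g x)%E) ->
  measurable_fun D g -> ae_eq mu D f g ->
  (\int[mu]_(x in D) f x = \int[mu]_(x in D) g x)%E.
Proof.
move=> mD f0 g0 mg fg; rewrite [LHS]integral_mkcond [RHS]integral_mkcond.
have F0 x : (0 <= (f \_ D) x)%E by rewrite patchE; case: ifP.
have G0 x : (0 <= (g \_ D) x)%E by rewrite patchE; case: ifP.
have mG : measurable_fun setT (g \_ D) by exact/(measurable_restrictT _ mD).
have [N [mN N0 subN]] := fg.
have FG x : ~ N x -> (f \_ D) x = (g \_ D) x.
  move=> NNx; rewrite !patchE; case: ifP => // /set_mem Dx.
  by apply: contrapT => fgx; apply: NNx; apply: subN => /= /(_ Dx).
apply/eqP; rewrite eq_le; apply/andP; split.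
  rewrite (ge0_integralTE mu F0); apply: ge_ereal_sup => _ [h hF <-].
  rewrite -integralT_nnsfun; apply: ae_ge0_le_integral => //.
  - by move=> x _; rewrite lee_fin; exact: fun_ge0.
  - by apply/measurable_EFinP; exact: measurable_funP.
  - exists N; split => // x /= H; apply: contrapT => NNx; apply: H => _.
    by rewrite -FG.
(* Put to 0 on the null set, [g] keeps its integral and lies below [f] everywhere, so the simple
   functions below it count for [f]. *)
rewrite (@ae_eq_integral _ _ _ _ _ ((g \_ D) \_ (~` N)))//; last 2 first.
- by apply/(measurable_restrictT _ (measurableC mN)); exact: measurable_funTS.
- exists N; split => // x /= H; apply: contrapT => NNx; apply: H => _.
  by rewrite [RHS]patchE mem_set.
have G'0 x : (0 <= ((g \_ D) \_ (~` N)) x)%E.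
  by rewrite patchE; case: ifP.
rewrite (ge0_integralTE mu F0) (ge0_integralTE mu G'0); apply: ereal_sup_le.
move=> _ [h hG <-]; exists h => // x; apply: le_trans (hG x) _.
by rewrite patchE; case: ifPn => // /set_mem NNx; rewrite FG.
Qed.

(** * A priori bounds in W^{4,1} *)

Section W41_estimates.
Context {R : realType}.
Variable L : R.
Hypothesis L_gt0 : 0 < L.
Implicit Types (f g w : R -> R).
Local Notation mu := (@lebesgue_measure R).

Lemma L1norm_ae_eq f g : L1 L g -> ae_eq mu `[0, L]%classic f g ->
  L1norm L f = L1norm L g.
Proof.
move=> gL fg; rewrite /L1norm /Rintegral; congr fine.
apply: ge0_ae_eq_integral => //.
  case/integrableP : gL => /measurable_EFinP mg _.
  by apply/measurable_EFinP; exact: measurableT_comp.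
have FF := ae_filter_ringOfSetsType mu.
by apply: (@filterS _ _ FF _ _ _ fg) => x H xL; rewrite H.
Qed.

Lemma W41_isD w : W41 L w -> forall j x, (j < 3)%N -> 0 <= x <= L ->
  isD L (nderiv L j w) x (nderiv L j.+1 w x).
Proof.
move=> [[wD _] _ _] j x j3 xL; apply: has_deriv_isD => //.
by apply: wD; rewrite ?in_itv.
Qed.

(** The third derivative and the primitive of [g] differ by an absolutely continuous function whose
    derivative is 0 almost everywhere, hence by a constant. *)
Lemma W41_osc w x y : W41 L w -> 0 <= x <= L -> 0 <= y <= L ->
  `|nderiv L 3 w y - nderiv L 3 w x| <= L1norm L (nderiv L 4 w).
Proof.
move=> [_ wac [g gL wg]] xL yL.
have -> : L1norm L (nderiv L 4 w) = L1norm L g.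
  apply: L1norm_ae_eq => //.
  have FF := ae_filter_ringOfSetsType mu.
  by apply: (@filterS _ _ FF _ _ _ wg) => z H zL; have [] := H zL.
have hac := abs_contB wac (primitive_abs_cont gL).
have h0 : {ae mu, forall x, x \in `[0, L] ->
    isD L (fun z => nderiv L 3 w z - primitive g z) x 0}.
  have FF := ae_filter_ringOfSetsType mu.
  apply: (@filterS2 _ _ FF _ _ _ _ wg (primitive_isD_ae gL)) => z H1 H2 zL.
  have [H3 H4] := H1 zL; have zL' : 0 <= z <= L by move: zL; rewrite in_itv.
  rewrite -(subrr (g z)); apply: isDB; last exact: H2.
  by rewrite -H4; exact: has_deriv_isD.
have := abs_cont_isD0_cst L_gt0 hac h0 xL yL => E.
have -> : nderiv L 3 w y - nderiv L 3 w x = primitive g y - primitive g x.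
  by move: E; lra.
exact: primitiveB_le_L1norm.
Qed.

(** Average [|f x| <= |f y| + D] over [y] in [0, L]. *)
Lemma L1norm_osc_bound f D : {within `[0, L], continuous f} ->
  (forall x y, 0 <= x <= L -> 0 <= y <= L -> `|f y - f x| <= D) ->
  forall x, 0 <= x <= L -> `|f x| <= L1norm L f / L + D.
Proof.
move=> fc fD x xL; rewrite -(ler_pM2r L_gt0) mulrDl divfK ?gt_eqF//.
have fL := L1_norm (continuous_L1 fc).
rewrite -!(integ_cst L_gt0) -[leRHS]integD//; last exact: L1_cst.
apply: le_integ; [exact: L1_cst|by apply: L1D => //; exact: L1_cst|move=> y yL].
rewrite -{1}(subrK (f y) (f x)) addrC (le_trans (ler_normD _ _))// lerD2l.
exact: fD.
Qed.

Lemma L1norm_le_W41norm w j : (j < 5)%N -> L1norm L (nderiv L j w) <= W41norm L w.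
Proof.
move=> j5; rewrite /W41norm (bigD1 (Ordinal j5))//= lerDl.
by apply: sumr_ge0 => i _; exact: L1norm_ge0.
Qed.

Lemma W41_bounded C : exists2 K, 0 <= K & forall w, W41 L w -> W41norm L w <= C ->
  forall j x, (j <= 3)%N -> 0 <= x <= L -> `|nderiv L j w x| <= K.
Proof.
have [C_lt0|C0] := ltP C 0.
  exists 0 => // w _ wC; have := L1norm_le_W41norm w (isT : (0 < 5)%N).
  by move=> /(le_trans (L1norm_ge0 _ _))/le_trans/(_ wC); rewrite leNgt C_lt0.
have CL : 0 <= C / L by rewrite divr_ge0// ltW.
(* [C / L] bounds the mean modulus of each derivative. The oscillation is at most [C] for the third
   one, and at most [L] times the bound on the next one for the others. *)
pose K3 := C / L + C; pose K2 := C / L + L * K3; pose K1 := C / L + L * K2.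
pose K0 := C / L + L * K1.
have K30 : 0 <= K3 by rewrite addr_ge0.
have K20 : 0 <= K2 by rewrite addr_ge0// mulr_ge0// ltW.
have K10 : 0 <= K1 by rewrite addr_ge0// mulr_ge0// ltW.
have K00 : 0 <= K0 by rewrite addr_ge0// mulr_ge0// ltW.
exists (K0 + K1 + K2 + K3) => [|w wW wC]; first by rewrite addr_ge0// addr_ge0// addr_ge0.
have [[_ wc] _ _] := wW.
have nC j : (j < 5)%N -> L1norm L (nderiv L j w) <= C.
  by move=> /(L1norm_le_W41norm w)/le_trans; exact.
have nCL j : (j < 5)%N -> L1norm L (nderiv L j w) / L <= C / L.
  by move=> j5; rewrite ler_wpM2r ?invr_ge0 ?(ltW L_gt0)// nC.
have b3 x : 0 <= x <= L -> `|nderiv L 3 w x| <= K3.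
  move=> xL; apply: le_trans (L1norm_osc_bound (D := C) (wc 3%N isT) _ xL) _.
    by move=> y z yL zL; exact: le_trans (W41_osc wW yL zL) (nC 4%N isT).
  by rewrite lerD2r nCL.
have step j K : (j < 3)%N -> 0 <= K ->
   (forall x, 0 <= x <= L -> `|nderiv L j.+1 w x| <= K) ->
   forall x, 0 <= x <= L -> `|nderiv L j w x| <= C / L + L * K.
  move=> j3 K_ge0 HK x xL; have j5 : (j < 5)%N by apply: ltn_trans j3 _.
  apply: le_trans (L1norm_osc_bound (wc j (ltnW j3)) (D := L * K) _ xL) _; last first.
    by rewrite lerD2r nCL.
  move=> y z yL zL.
  apply: le_trans (isD_lipschitz L_gt0 K_ge0 (fun t => W41_isD wW j3) HK yL zL) _.
  rewrite mulrC ler_wpM2r// ler_norml; move: yL zL => /andP[? ?] /andP[? ?].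
  by apply/andP; split; lra.
have b2 := step 2%N _ isT K30 b3.
have b1 := step 1%N _ isT K20 b2.
have b0 := step 0%N _ isT K10 b1.
move=> [|[|[|[|//]]]] x _ xL.
- by have := b0 x xL; rewrite -/K0; lra.
- by have := b1 x xL; rewrite -/K1; lra.
- by have := b2 x xL; rewrite -/K2; lra.
- by have := b3 x xL; lra.
Qed.

End W41_estimates.

(** * Compactness of the embedding of W^{4,1} in C^2 *)

Section compact_embedding.
Context {R : realType}.
Variable L : R.
Hypothesis L_gt0 : 0 < L.

(** A cluster point exists by compactness of [[- K, K]], and for an ultrafilter it is a limit: if
    the indices with [|u n - l| > e] belonged to [G], the values could not cluster at [l]. *)
Lemma ultra_cvg_bounded (G : set_system nat) (u : nat -> R) (K : R) :
  UltraFilter G -> (forall n, `|u n| <= K) ->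
  exists l : R, forall e, 0 < e -> G [set n | `|u n - l| <= e].
Proof.
move=> UG uK; have PG : ProperFilter G := @ultra_proper _ _ UG.
have [|l [_ clu]] := @segment_compact R (- K) K (u @ G) _.
  suff : G [set n | u n \in `[- K, K]] by [].
  by apply: filterE => n /=; have := uK n; rewrite ler_norml in_itv.
exists l => e e0; have [//|Gn] := in_ultra_setVsetC [set n | `|u n - l| <= e] UG.
have [||y [/=]] := clu [set y | e < `|y - l|] (ball l e).
- suff : G [set n | e < `|u n - l|] by [].
  by apply: filterS Gn => n /= H; rewrite ltNge; apply/negP.
- by apply: nbhsx_ballx.
rewrite /ball/= distrC => ey ye; by have := lt_trans ey ye; rewrite ltxx.
Qed.

(* A limit along a fixed ultrafilter finer than [\oo] replaces the diagonal
   extraction of the Arzela-Ascoli theorem. *)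
Lemma equilipschitz_subsequence (m : nat) (f : nat -> nat -> R -> R) (K : R) :
  0 <= K ->
  (forall j n x, (j < m)%N -> 0 <= x <= L -> `|f j n x| <= K) ->
  (forall j n x y, (j < m)%N -> 0 <= x <= L -> 0 <= y <= L ->
    `|f j n y - f j n x| <= K * `|y - x|) ->
  exists (k : nat -> nat) (g : nat -> R -> R),
    {homo k : p q / (p < q)%N} /\
    forall j n x, (j < m)%N -> 0 <= x <= L -> `|f j (k n) x - g j x| <= n.+1%:R^-1.
Proof.
move=> K0 fK fL.
have [G [UG ooG]] := @ultraFilterLemma nat \oo _.
have PG : ProperFilter G := @ultra_proper _ _ UG.
have /choice[g Hg] : forall j, exists gj : R -> R, forall x e, (j < m)%N ->
    0 <= x <= L -> 0 < e -> G [set n | `|f j n x - gj x| <= e].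
  move=> j; have /choice[gj Hgj] : forall x, exists l : R, forall e, (j < m)%N ->
      0 <= x <= L -> 0 < e -> G [set n | `|f j n x - l| <= e].
    move=> x; have [jm|jm] := boolP (j < m)%N; last by exists 0.
    have [xL|xL] := boolP (0 <= x <= L); last by exists 0.
    have [l Hl] := ultra_cvg_bounded UG (fun n => fK j n x jm xL).
    by exists l => e _ _; exact: Hl.
  by exists gj.
have gL j x y : (j < m)%N -> 0 <= x <= L -> 0 <= y <= L ->
    `|g j y - g j x| <= K * `|y - x|.
  move=> jm xL yL; apply/ler_addgt0Pl => e e0.
  have e2 : 0 < e / 2 by rewrite divr_gt0.
  have [n [/= nx ny]] := filter_ex (filterI (Hg j x _ jm xL e2) (Hg j y _ jm yL e2)).
  have -> : g j y - g j x =
    (f j n y - f j n x) + ((f j n x - g j x) - (f j n y - g j y)) by ring.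
  rewrite addrC (le_trans (ler_normD _ _))// lerD ?fL//.
  by rewrite (le_trans (ler_normB _ _))// [leRHS]splitr lerD.
have unif e : 0 < e ->
    G [set n | forall j x, (j < m)%N -> 0 <= x <= L -> `|f j n x - g j x| <= e].
  move=> e0.
  have unif1 j : (j < m)%N ->
      G [set n | forall x, 0 <= x <= L -> `|f j n x - g j x| <= e].
    move=> jm.
    (* Uniform closeness passes to unions of adjacent intervals because [G] is closed under
       intersection, and it holds on short intervals by equicontinuity; Cousin's lemma plays the
       part of a finite subcover. *)
    refine (@cousin R L (fun u v => G [set n | forall x, u <= x <= v ->
      `|f j n x - g j x| <= e]) _ _ 0 L (lexx _) (ltW L_gt0) (lexx _)).
      move=> u v w u0 uv vw wL Guv Gvw.
      apply: filterS (filterI Guv Gvw) => n [/= Hu Hv] x /andP[ux xw].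
      by have [xv|/ltW vx] := leP x v; [apply: Hu; rewrite ux|apply: Hv; rewrite vx].
    move=> t tL; have e2 : 0 < e / 2 by rewrite divr_gt0.
    have K1 : 0 < 2 * K + 1 by rewrite ltr_wpDl// mulr_ge0.
    (* Moving from [t] to [x] costs at most [K * (v - u)] for [f j n] and as much for [g j], whence
       [2 * K]; the added 1 keeps the denominator positive. *)
    exists (e / 2 / (2 * K + 1)) => [|u v u0 ut tv vL]; first by rewrite divr_gt0.
    rewrite ltr_pdivlMr// => uv; apply: filterS (Hg j t _ jm tL e2) => n /= Hn x.
    move=> /andP[ux xv]; have xL : 0 <= x <= L by rewrite (le_trans u0 ux) (le_trans xv vL).
    have xt : `|x - t| <= v - u by rewrite ler_norml; apply/andP; split; lra.
    have -> : f j n x - g j x =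
      (f j n t - g j t) + ((f j n x - f j n t) - (g j x - g j t)) by ring.
    rewrite (le_trans (ler_normD _ _))// (splitr e) lerD//.
    rewrite (le_trans (ler_normB _ _))//.
    have := lerD (fL j n t x jm tL xL) (gL j t x jm tL xL).
    have := ler_wpM2l K0 xt; have vu0 : 0 <= v - u by rewrite subr_ge0 (le_trans ut).
    by move: uv; lra.
  have : forall p, (p <= m)%N -> G [set n | forall j x, (j < p)%N -> 0 <= x <= L ->
      `|f j n x - g j x| <= e].
    elim=> [_|p IH pm]; first by apply: filterE => n j x.
    apply: filterS (filterI (IH (ltnW pm)) (unif1 p pm)) => n [/= Hp Hn] j x.
    by rewrite ltnS leq_eqVlt => /predU1P[->|jp] xL; [exact: Hn|exact: Hp].
  by move=> /(_ m (leqnn m)).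
have /choice[c Hc] : forall pq : nat * nat, exists n, (pq.1 < n)%N /\
    forall j x, (j < m)%N -> 0 <= x <= L -> `|f j n x - g j x| <= pq.2.+1%:R^-1.
  move=> [p q]; have q0 : 0 < q.+1%:R^-1 :> R by rewrite invr_gt0 ltr0n.
  have Gp : G [set n | (p < n)%N] by apply: ooG; exists p.+1.
  by have [n [/= pn Hn]] := filter_ex (filterI Gp (unif _ q0)); exists n.
(* Each index exceeds the previous one, and the one of rank [n] has accuracy [1 / (n + 1)]. *)
pose k := fix k n := if n is n'.+1 then c (k n', n) else c (0, 0)%N.
exists k, g; split.
  apply: homo_ltn => [p q r|n]; first exact: ltn_trans.
  by have [] := Hc (k n, n.+1).
by move=> j [|n] x; [have [_] := Hc (0, 0)%N|have [_] := Hc (k n, n.+1)]; exact.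
Qed.

Lemma W41_compact_C2 : W41_compactly_embedded_in_C2 L.
Proof.
split=> [w [[wD wc] _ _]|w_ C w_C].
  by split=> j j2; [apply: wD|apply: wc]; apply: leq_trans j2 _.
have [K K0 wK] := W41_bounded L_gt0 C.
pose f j n := nderiv L j (w_ n).
have fK j n x : (j < 3)%N -> 0 <= x <= L -> `|f j n x| <= K.
  by move=> j3 xL; have [wW wC] := w_C n; apply: wK => //; exact: ltnW.
have fD j n x : (j < 3)%N -> 0 <= x <= L -> isD L (f j n) x (f j.+1 n x).
  by move=> j3 xL; have [wW _] := w_C n; exact: W41_isD.
have fL j n x y : (j < 3)%N -> 0 <= x <= L -> 0 <= y <= L ->
    `|f j n y - f j n x| <= K * `|y - x|.
  move=> j3 xL yL; have [wW wC] := w_C n.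
  apply: (isD_lipschitz L_gt0 K0 (f' := f j.+1 n)) => // z zL; first exact: fD.
  exact: wK.
have [k [g [kmono kg]]] := equilipschitz_subsequence K0 fK fL.
have kg_ex (e : R) : 0 < e -> exists n, n.+1%:R^-1 <= e.
  move=> e0; exists (Num.truncn e^-1).
  rewrite -[leRHS]invrK lef_pV2 ?posrE ?invr_gt0 ?ltr0n//.
  by apply/ltW; rewrite truncnS_gt.
have gD j x : (j < 2)%N -> 0 <= x <= L -> isD L (g j) x (g j.+1 x).
  move=> j2 xL; have j3 : (j < 3)%N by apply: ltn_trans j2 _.
  (* The Taylor bound of the approximants has the same constant [K] for every [n], so the limit
     inherits it; this is what makes [g j] differentiable. The denominator [2 + |y - x|] counts the
     errors at [y], at [x] and in the slope. *)
  apply: (isD_lip K0) => y yL; apply/ler_addgt0Pl => e e0.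
  have D0 : 0 < 2 + `|y - x| by rewrite ltr_wpDr.
  have [n ne] := kg_ex (e / (2 + `|y - x|)) (divr_gt0 e0 D0).
  have h1 := le_trans (kg j n y j3 yL) ne.
  have h2 := le_trans (kg j n x j3 xL) ne.
  have h3 := le_trans (kg j.+1 n x j2 xL) ne.
  have h4 := isD_taylor L_gt0 K0 (fun z => @fD j (k n) z j3)
    (fun z t => fL j.+1 (k n) z t j2) xL yL.
  have -> : g j y - g j x - g j.+1 x * (y - x) =
     (f j (k n) y - f j (k n) x - f j.+1 (k n) x * (y - x)) +
     (- (f j (k n) y - g j y) + (f j (k n) x - g j x)
       + (f j.+1 (k n) x - g j.+1 x) * (y - x)) by ring.
  rewrite [leRHS]addrC (le_trans (ler_normD _ _))// lerD//.
  rewrite (le_trans (ler_normD _ _))// normrM.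
  have -> : e = e / (2 + `|y - x|) + e / (2 + `|y - x|) +
      e / (2 + `|y - x|) * `|y - x| by field; rewrite gt_eqF.
  rewrite lerD//; last by rewrite ler_wpM2r.
  by rewrite (le_trans (ler_normD _ _))// normrN lerD.
have gL x y : 0 <= x <= L -> 0 <= y <= L -> `|g 2 y - g 2 x| <= K * `|y - x|.
  move=> xL yL; apply/ler_addgt0Pl => e e0.
  have [n ne] := kg_ex (e / 2) (divr_gt0 e0 (ltr0n _ 2)).
  have h1 := le_trans (kg 2 n y isT yL) ne.
  have h2 := le_trans (kg 2 n x isT xL) ne.
  have -> : g 2 y - g 2 x = (f 2 (k n) y - f 2 (k n) x) +
    ((f 2 (k n) x - g 2 x) - (f 2 (k n) y - g 2 y)) by ring.
  rewrite [leRHS]addrC (le_trans (ler_normD _ _))// lerD ?fL//.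
  by rewrite (le_trans (ler_normB _ _))// [leRHS]splitr lerD.
have gc : {within `[0, L], continuous (g 2)}.
  apply: abs_cont_continuous => //; exact: lipschitz_abs_cont K0 gL.
exists k, (g 0%N); split => //.
  exact: (isD_chain_Ck L_gt0 (d := g) (n := 2)).
have E n j x : (j <= 2)%N -> 0 <= x <= L ->
    nderiv L j (w_ (k n) \- g 0%N) x = f j (k n) x - g j x.
  apply: (isD_chain_nderiv L_gt0 (d := fun j x => f j (k n) x - g j x)) => //.
  move=> i z i2 zL; apply: isDB; last exact: gD.
  by apply: fD => //; apply: ltn_trans i2 _.
apply/cvgrPdist_le => e e0; near=> n.
have n0 : n.+1%:R^-1 <= e / 3.
  near: n; have e3 : 0 < e / 3 by rewrite divr_gt0.
  exists (Num.truncn (e / 3)^-1) => // p /= np.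
  rewrite -[leRHS]invrK lef_pV2 ?posrE ?invr_gt0 ?ltr0n//.
  apply/ltW/(lt_le_trans (truncnS_gt _)).
  by rewrite ler_nat ltnS.
rewrite sub0r normrN /Cknorm !big_ord_recr big_ord0/= add0r.
have S j : (j <= 2)%N ->
    `|sup [set `|nderiv L j (w_ (k n) \- g 0%N) x| | x in `[0, L]]| <= e / 3.
  move=> j2; set S := [set _ | _ in _].
  have S0 : S `|nderiv L j (w_ (k n) \- g 0%N) 0|.
    by exists 0 => //=; rewrite in_itv/= lexx ltW.
  have Se : ubound S (e / 3).
    move=> _ [x + <-]; rewrite /= in_itv/= => xL; rewrite E//.
    by apply: le_trans n0; apply: kg.
  have sS : sup S <= e / 3 by apply: ge_sup => //; eexists; exact: S0.
  rewrite ger0_norm//; apply: le_trans (normr_ge0 _) (ub_le_sup _ S0).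
  by exists (e / 3).
have := S 0%N isT; have := S 1%N isT; have := S 2%N isT.
move=> s2 s1 s0; rewrite (le_trans (ler_normD _ _))//.
have := ler_normD (sup [set `|nderiv L 0 (w_ (k n) \- g 0%N) x| | x in `[0, L]])
  (sup [set `|nderiv L 1 (w_ (k n) \- g 0%N) x| | x in `[0, L]]).
by move: s0 s1 s2; rewrite /=; lra.
Unshelve. all: by end_near. Qed.

End compact_embedding.

(** * Hyperbolic functions and their inequalities *)

Section hyperbolic_functions.
Context {R : realType}.
Implicit Types (L r x y t : R).

Lemma sinh0 : sinh 0 = 0 :> R.
Proof. by rewrite /sinh oppr0 subrr mul0r. Qed.

Lemma cosh0 : cosh 0 = 1 :> R.
Proof. by rewrite /cosh oppr0 expR0; field. Qed.

Lemma sinhD x y : sinh (x + y) = sinh x * cosh y + cosh x * sinh y.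
Proof. by rewrite /sinh /cosh opprD !expRD; field. Qed.

Lemma cosh2_sinh2 x : cosh x ^+ 2 - sinh x ^+ 2 = 1.
Proof.
rewrite /sinh /cosh expRN; have := expR_gt0 x; move: (expR x) => E E0.
by field; rewrite gt_eqF.
Qed.

(** The two branches of the kernels differ by exchanging [x] and [s]; by this identity the
    hyperbolic part of the difference is, up to a factor, a function of [x - s] alone. *)
Lemma sinh_exchange r L x s :
  sinh (r * x) * sinh (r * (L - s)) - sinh (r * s) * sinh (r * (L - x)) =
  sinh (r * (x - s)) * sinh (r * L).
Proof.
rewrite /sinh !mulrBr !opprB !expRB !expRN.
have := expR_gt0 (r * x); have := expR_gt0 (r * s); have := expR_gt0 (r * L).
move: (expR _) (expR _) (expR _) => E F G E0 F0 G0.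
by field; rewrite !gt_eqF.
Qed.

Lemma cosh_gt0 x : 0 < cosh x.
Proof. by rewrite divr_gt0// addr_gt0// expR_gt0. Qed.

Lemma sinh_ge0 x : 0 <= x -> 0 <= sinh x.
Proof. by move=> x0; rewrite divr_ge0// subr_ge0 ler_expR; lra. Qed.

Lemma sinh_gt0 x : 0 < x -> 0 < sinh x.
Proof. by move=> x0; rewrite divr_gt0// subr_gt0 ltr_expR; lra. Qed.

Lemma sinh_le_cosh x : sinh x <= cosh x.
Proof.
by rewrite ler_wpM2r// lerD2l ge0_cp// ltW// expR_gt0.
Qed.

Lemma tanh_half x : 0 < x -> (cosh x - 1) / sinh x = tanh (x / 2).
Proof.
move=> x0; have s0 := sinh_gt0 x0; move: s0.
rewrite /tanh; set y := x / 2; have -> : x = y + y by rewrite /y; field.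
rewrite /sinh /cosh opprD !expRD expRN; have := expR_gt0 y.
move: (expR y) => E E0 s0.
have E2 : E * E - E^-1 * E^-1 != 0.
  by apply: contraTneq s0 => ->; rewrite mul0r ltxx.
have E3 : E * E + 1 != 0 by rewrite gt_eqF// addr_gt0// mulr_gt0.
have E4 : E * E - 1 != 0.
  apply: contra_neq E2 => /eqP; rewrite subr_eq0 => /eqP EE.
  by rewrite -invfM EE invr1 subrr.
field; rewrite gt_eqF//= E3 /=.
have -> : E ^+ 2 ^+ 2 - 1 = (E * E - 1) * (E * E + 1) by ring.
by rewrite mulf_neq0.
Qed.

Lemma isD_expR L r x : isD L (fun y => expR (r * y)) x (r * expR (r * x)).
Proof.
apply: is_derive_isD; apply: is_derive_eq.
by rewrite /GRing.scale/= mulr1 mulrC.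
Qed.

Lemma isD_sinh L r x : isD L (fun y => sinh (r * y)) x (r * cosh (r * x)).
Proof.
have H := isDB (isDZ 2^-1 (isD_expR L r x)) (isDZ 2^-1 (isD_expR L (- r) x)).
move=> e /H [d d0 Hd]; exists d => // y yL yd; have := Hd y yL yd.
by rewrite /sinh /cosh !mulNr; congr (`|_| <= _); field.
Qed.

Lemma isD_cosh L r x : isD L (fun y => cosh (r * y)) x (r * sinh (r * x)).
Proof.
have H := isDD (isDZ 2^-1 (isD_expR L r x)) (isDZ 2^-1 (isD_expR L (- r) x)).
move=> e /H [d d0 Hd]; exists d => // y yL yd; have := Hd y yL yd.
by rewrite /sinh /cosh !mulNr; congr (`|_| <= _); field.
Qed.

Lemma isD_cst L (k : R) x : isD L (fun=> k) x 0.
Proof.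
by move=> e e0; exists 1 => // y _ _; rewrite subrr mul0r subr0 normr0 mulr_ge0// ltW.
Qed.

Lemma isD_id L x : isD L (fun y => y) x 1.
Proof.
by move=> e e0; exists 1 => // y _ _; rewrite mul1r subrr normr0 mulr_ge0// ltW.
Qed.

Lemma isD_sqr L x : isD L (fun y => y ^+ 2) x (2 * x).
Proof.
apply: (@isD_lip _ L _ x _ 1) => // y _.
rewrite -normrX mul1r; have -> : y ^+ 2 - x ^+ 2 - 2 * x * (y - x) = (y - x) ^+ 2 by ring.
by [].
Qed.

Lemma isD_cube L x : 0 <= x <= L -> isD L (fun y => y ^+ 3) x (3 * x ^+ 2).
Proof.
move=> /andP[x0 xL]; have L0 : 0 <= L by exact: le_trans xL.
apply: (@isD_lip _ L _ x _ (3 * L)) => [|y /andP[y0 yL]]; first by rewrite mulr_ge0.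
have -> : y ^+ 3 - x ^+ 3 - 3 * x ^+ 2 * (y - x) = (y + 2 * x) * (y - x) ^+ 2.
  by ring.
rewrite normrM normrX ler_wpM2r ?exprn_ge0// ger0_norm; first by lra.
by rewrite addr_ge0// mulr_ge0.
Qed.

Lemma isD_val L (f : R -> R) x l m : l = m -> isD L f x l -> isD L f x m.
Proof. by move->. Qed.

Lemma isD_ge0_nondecreasing L (f f' : R -> R) : 0 < L ->
  (forall x, 0 <= x <= L -> isD L f x (f' x)) ->
  (forall x, 0 <= x <= L -> 0 <= f' x) ->
  forall x y, 0 <= x -> x <= y -> y <= L -> f x <= f y.
Proof.
move=> L0 fD f'0 x y x0 xy yL; apply/ler_addgt0Pl => e e0.
have e1 : 0 < e / (L + 1) by rewrite divr_gt0// ltr_wpDl// ltW.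
have : f x <= f y + e / (L + 1) * (y - x).
  refine (@cousin R L (fun u v => f u <= f v + e / (L + 1) * (v - u))
    _ _ x y x0 xy yL).
    by move=> u v w _ _ _ _ H1 H2; apply: le_trans H1 _; lra.
  move=> t tL; have [d d0 Hd] := fD t tL _ e1; exists d => // u v u0 ut tv vL uv.
  have ft := f'0 t tL; move: tL => /andP[t0 tL].
  have := Hd u; rewrite u0 (le_trans ut)//= distrC ger0_norm ?subr_ge0//.
  move=> /(_ isT (le_lt_trans (lerB tv (lexx u)) uv)).
  have := Hd v; rewrite vL (le_trans t0)//= ger0_norm ?subr_ge0//.
  move=> /(_ isT (le_lt_trans (lerB (lexx v) ut) uv)).
  rewrite !ler_norml => /andP[H1 _] /andP[_ H2].
  have := mulr_ge0 ft (_ : 0 <= v - t); rewrite subr_ge0 => /(_ tv).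
  have := mulr_ge0 ft (_ : 0 <= t - u); rewrite subr_ge0 => /(_ ut).
  move: H1 H2; lra.
move=> /le_trans; apply; rewrite addrC lerD2r mulrAC ler_pdivrMr ?ltr_wpDl ?(ltW L0)//.
by rewrite ler_wpM2l ?(ltW e0)//; lra.
Qed.

Lemma isDM L (f g : R -> R) x l m : isD L f x l -> isD L g x m ->
  isD L (fun y => f y * g y) x (l * g x + f x * m).
Proof.
move=> fD gD.
have H : isD L (fun y => (f y - f x) * (g y - g x)) x 0.
  move=> e e0; have [d d0 Hd] := fD _ ltr01; have [d' d'0 Hd'] := gD _ ltr01.
  have l0 : 0 < `|l| + 1 by rewrite ltr_wpDl.
  have m0 : 0 < `|m| + 1 by rewrite ltr_wpDl.
  exists (Num.min (Num.min d d') (e / ((`|l| + 1) * (`|m| + 1)))).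
    by rewrite !lt_min d0 d'0 divr_gt0// mulr_gt0.
  move=> y yL; rewrite !lt_min => /andP[/andP[yd yd']].
  rewrite ltr_pdivlMr ?mulr_gt0// => ye.
  have F : `|f y - f x| <= (`|l| + 1) * `|y - x|.
    rewrite -(subrK (l * (y - x)) (f y - f x)) (le_trans (ler_normD _ _))//.
    by rewrite normrM [leRHS]mulrDl addrC lerD2l; exact: Hd.
  have G : `|g y - g x| <= (`|m| + 1) * `|y - x|.
    rewrite -(subrK (m * (y - x)) (g y - g x)) (le_trans (ler_normD _ _))//.
    by rewrite normrM [leRHS]mulrDl addrC lerD2l; exact: Hd'.
  rewrite subrr mul0r subr0 mul0r subr0 normrM (le_trans (ler_pM _ _ F G))//.
  rewrite mulrACA mulrA ler_wpM2r// mulrC; exact: ltW.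
have E := isDD (isDD (isDZ (g x) fD) (isDZ (f x) gD)) H.
move=> e /E [d d0 Hd]; exists d => // y yL yd; have := Hd y yL yd.
by congr (`|_| <= _); ring.
Qed.

Lemma cosh_ge1 x : 1 <= cosh x.
Proof.
rewrite -(@ler_pXn2r _ 2) ?nnegrE ?(ltW (cosh_gt0 x))// expr1n.
by rewrite -(cosh2_sinh2 x) lerBlDr lerDl sqr_ge0.
Qed.

(** The derivative of [y * cosh y - sinh y] is [y * sinh y], which is nonnegative. The interval of
    length [x + 1] is nondegenerate even for [x = 0]. *)
Lemma sinh_le_mul_cosh x : 0 <= x -> sinh x <= x * cosh x.
Proof.
move=> x0; have L0 : 0 < x + 1 by rewrite ltr_wpDl.
have D y : 0 <= y <= x + 1 ->
    isD (x + 1) (fun z => z * cosh (1 * z) - sinh (1 * z)) y (y * sinh y).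
  move=> yL; have := isDB (isDM (isD_id _ y) (isD_cosh (x + 1) 1 y)) (isD_sinh _ 1 y).
  by apply: isD_val; rewrite !mul1r; ring.
have := isD_ge0_nondecreasing L0 D _ (lexx 0) x0.
rewrite mul0r mulr0 sinh0 !mul1r subr0 subr_ge0; apply; last by rewrite lerDl.
by move=> y /andP[y0 _]; rewrite mulr_ge0// sinh_ge0.
Qed.

(** The derivative in [z] of [x * sinh (x + z) - sinh x * (x + z)] is [x * cosh (x + z) - sinh x],
    nonnegative by [sinh_le_mul_cosh] since [cosh (x + z) >= cosh x]. The outcome is the
    monotonicity of [sinh t / t]. *)
Lemma sinh_div_nondecreasing x y : 0 <= x -> x <= y -> y * sinh x <= x * sinh y.
Proof.
move=> x0 xy; pose t := y - x; have t0 : 0 <= t by rewrite subr_ge0.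
have L0 : 0 < t + 1 by rewrite ltr_wpDl.
pose f z := x * (sinh x * cosh (1 * z) + cosh x * sinh (1 * z)) - sinh x * (x + z).
have D z : 0 <= z <= t + 1 -> isD (t + 1) f z
    (x * (sinh x * sinh z + cosh x * cosh z) - sinh x).
  move=> zL; have := isDB (isDZ x (isDD (isDZ (sinh x) (isD_cosh (t + 1) 1 z))
    (isDZ (cosh x) (isD_sinh (t + 1) 1 z))))
    (isDZ (sinh x) (isDD (isD_cst (t + 1) x z) (isD_id (t + 1) z))).
  by apply: isD_val; rewrite !mul1r; ring.
have := isD_ge0_nondecreasing L0 D _ (lexx 0) t0.
rewrite /f mulr0 !mul1r sinh0 cosh0 -sinhD.
have -> : x + t = y by rewrite /t; ring.
have -> : x * (sinh x * 1 + cosh x * 0) - sinh x * (x + 0) = 0 by ring.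
rewrite subr_ge0 mulrC; apply; last by rewrite lerDl.
move=> z /andP[z0 _]; rewrite subr_ge0 (le_trans (sinh_le_mul_cosh x0))//.
rewrite ler_wpM2l// ler_wpDl//; first by rewrite mulr_ge0// sinh_ge0.
by rewrite ler_peMr ?cosh_ge1// ltW// cosh_gt0.
Qed.

(** With [p = x] and [q = L - s] this compares the two Dirichlet kernels and so gives the sign of
    [green]. The addition formula and [sinh_le_mul_cosh] yield it with [p + q] in place of [L], and
    the monotonicity of [sinh t / t] leads from [p + q] to [L]. *)
Lemma sinh_product_le (r L p q : R) : 0 <= r -> 0 <= p -> 0 <= q -> p + q <= L ->
  L * (sinh (r * p) * sinh (r * q)) <= p * q * (r * sinh (r * L)).
Proof.
move=> r0 p0 q0 pqL.
have [P0|] := eqVneq (p + q) 0.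
  have [-> ->] : p = 0 /\ q = 0 by split; lra.
  by rewrite !(mul0r, mulr0) sinh0 mul0r mulr0.
have P0 : 0 <= p + q by exact: addr_ge0.
move=> PN0; have {PN0}P1 : 0 < p + q by rewrite lt_neqAle eq_sym PN0.
have rp : 0 <= r * p by rewrite mulr_ge0.
have rq : 0 <= r * q by rewrite mulr_ge0.
have sp := sinh_ge0 rp; have sq := sinh_ge0 rq.
have hp := sinh_le_mul_cosh rp; have hq := sinh_le_mul_cosh rq.
have [r_eq0|rN0] := eqVneq r 0; first by rewrite r_eq0 !mul0r sinh0 mul0r !mulr0.
have r1 : 0 < r by rewrite lt_neqAle eq_sym rN0.
have H1 : L * sinh (r * (p + q)) <= (p + q) * sinh (r * L).
  have := sinh_div_nondecreasing (mulr_ge0 r0 P0) (ler_wpM2l r0 pqL).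
  by rewrite -!mulrA ler_pM2l.
have H2 : (p + q) * (sinh (r * p) * sinh (r * q)) <=
    p * q * (r * sinh (r * (p + q))).
  rewrite mulrDr sinhD.
  have := ler_wpM2r (mulr_ge0 q0 sq) hp; have := ler_wpM2r (mulr_ge0 p0 sp) hq.
  by lra.
rewrite -(ler_pM2l P1).
have L0 : 0 <= L by exact: le_trans pqL.
have := ler_wpM2l L0 H2; have := ler_wpM2l (mulr_ge0 (mulr_ge0 p0 q0) r0) H1.
by lra.
Qed.

Lemma continuous_sinh r : continuous (fun t => sinh (r * t)).
Proof.
move=> t; apply: cvgM; last exact: cvg_cst; apply: cvgB; apply: continuous_comp.
- by apply: cvgM; [exact: cvg_cst|exact: cvg_id].
- exact: continuous_expR.
- by apply: cvgN; apply: cvgM; [exact: cvg_cst|exact: cvg_id].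
- exact: continuous_expR.
Qed.

Lemma continuous_cosh r : continuous (fun t => cosh (r * t)).
Proof.
move=> t; apply: cvgM; last exact: cvg_cst; apply: cvgD; apply: continuous_comp.
- by apply: cvgM; [exact: cvg_cst|exact: cvg_id].
- exact: continuous_expR.
- by apply: cvgN; apply: cvgM; [exact: cvg_cst|exact: cvg_id].
- exact: continuous_expR.
Qed.

End hyperbolic_functions.

(** * Differentiation under the integral and Volterra kernels *)

Section volterra.
Context {R : realType}.
Variable L : R.
Hypothesis L_gt0 : 0 < L.
Implicit Types (k phi : R -> R).
Local Notation mu := (@lebesgue_measure R).

(* Differentiation under the integral sign, by dominated convergence; the kernel
   need not be differentiable on the diagonal. *)
Lemma isD_integ (K : R -> R -> R) (K1 phi : R -> R) (x B C : R) :
  0 <= x <= L -> L1 L phi ->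
  (forall y, 0 <= y <= L -> measurable_fun `[0, L] (K y)) ->
  measurable_fun `[0, L] K1 ->
  (forall y s, 0 <= y <= L -> 0 <= s <= L -> `|K y s| <= B) ->
  (forall s, 0 <= s <= L -> `|K1 s| <= B) ->
  (forall y s, 0 <= y <= L -> 0 <= s <= L -> `|K y s - K x s| <= C * `|y - x|) ->
  (forall s, 0 <= s <= L -> s != x -> isD L (K^~ s) x (K1 s)) ->
  isD L (fun y => integ L (fun s => K y s * phi s)) x
    (integ L (fun s => K1 s * phi s)).
Proof.
move=> xL phiL mK mK1 KB K1B KC KD.
have iK y : 0 <= y <= L -> L1 L (fun s => K y s * phi s).
  by move=> yL; apply: L1_bounded_mul (mK y yL) _ phiL => s; exact: KB.
have iK1 : L1 L (fun s => K1 s * phi s) by exact: L1_bounded_mul mK1 K1B phiL.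
(* Dominated convergence speaks of sequences, so a failure of the derivative is turned into a
   sequence [y n] tending to [x] along which the error exceeds [e * |y n - x|]. *)
apply: contrapT => nD.
have [e e0 He] : exists2 e, 0 < e & forall d, 0 < d -> exists y, [/\ 0 <= y <= L,
    `|y - x| < d & e * `|y - x| < `|integ L (fun s => K y s * phi s) -
      integ L (fun s => K x s * phi s) - integ L (fun s => K1 s * phi s) * (y - x)| ].
  apply: contrapT => H; apply: nD => e e0; apply: contrapT => H1; apply: H.
  exists e => // d d0; apply: contrapT => H2; apply: H1; exists d => // y yL yd.
  by rewrite leNgt; apply/negP => H3; apply: H2; exists y.
have /choice[y Hy] : forall n : nat, exists y, [/\ 0 <= y <= L,
    `|y - x| < n.+1%:R^-1 & e * `|y - x| < `|integ L (fun s => K y s * phi s) -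
      integ L (fun s => K x s * phi s) - integ L (fun s => K1 s * phi s) * (y - x)| ].
  by move=> n; apply: He; rewrite invr_gt0 ltr0n.
have yL n : 0 <= y n <= L by have [] := Hy n.
have yNx n : y n - x != 0.
  apply/eqP => yx; have [_ _] := Hy n; rewrite yx normr0 !mulr0 subr0.
  have -> : y n = x by apply/eqP; rewrite -subr_eq0 yx.
  by rewrite subrr normr0 ltxx.
have yx : y n - x @[n --> \oo] --> (0 : R).
  apply/cvgrPdist_le => d d0; near=> n; rewrite sub0r normrN.
  have [_ /lt_trans + _] := Hy n; move=> /(_ d) H; apply/ltW/H; near: n.
  exact: (near_infty_natSinv_lt (PosNum d0)).
(* These difference quotients of the integrand are dominated by [C * |phi s|], by the Lipschitz
   bound, and converge except perhaps at [s = x]. *)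
pose f n s := (y n - x)^-1 * (K (y n) s * phi s - K x s * phi s).
have if_ n : L1 L (f n) by apply: L1Z; apply: L1B; exact: iK.
have C0 : 0 <= C.
  have n0 : 0 < `|y 0%N - x| by rewrite normr_gt0.
  have L00 : 0 <= (0 : R) <= L by rewrite lexx ltW.
  by rewrite -(pmulr_lge0 _ n0) (le_trans _ (KC _ 0 (yL 0%N) L00)).
have fC n s : 0 <= s <= L -> `|f n s| <= C * `|phi s|.
  move=> sL; rewrite /f -mulrBl mulrA normrM ler_wpM2r// normrM normfV.
  by rewrite mulrC ler_pdivrMr ?normr_gt0// KC.
have fcvg s : 0 <= s <= L -> s != x -> f n s @[n --> \oo] --> K1 s * phi s.
  move=> sL sx; apply/cvgrPdist_le => d d0.
  have p0 : 0 < `|phi s| + 1 by rewrite ltr_wpDl.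
  have [r r0 Hr] := KD s sL sx _ (divr_gt0 d0 p0); near=> n.
  have yr : `|y n - x| < r.
    near: n; move/cvgrPdist_lt : yx => /(_ r r0); apply: filterS => n.
    by rewrite sub0r normrN.
  have n0 : 0 < `|y n - x| by rewrite normr_gt0.
  have H := Hr _ (yL n) yr; rewrite -(ler_pM2r n0) -normrM /f.
  have -> : (K1 s * phi s - (y n - x)^-1 * (K (y n) s * phi s - K x s * phi s)) *
    (y n - x) = - ((K (y n) s - K x s - K1 s * (y n - x)) * phi s).
    by field; exact: yNx.
  rewrite normrN normrM (le_trans (ler_wpM2r (normr_ge0 _) H))//.
  rewrite mulrAC ler_wpM2r// mulrAC ler_pdivrMr// ler_wpM2l ?(ltW d0)//.
  by rewrite lerDl.
have [] := @dominated_convergence _ _ R mu `[0, L] _ (fun n => EFin \o f n)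
  (EFin \o (fun s => K1 s * phi s)) (EFin \o (fun s => C * `|phi s|)).
- exact: measurable_itv.
- by move=> n; apply/measurable_EFinP; exact: L1_measurable.
- by apply/measurable_EFinP; exact: L1_measurable.
- exists [set x]; split => //; first exact: lebesgue_measure_set1.
  move=> s /= H; apply: contrapT => /eqP sx; apply: H; rewrite in_itv/= => sL.
  by apply: cvg_EFin; [exact: nearW|exact: fcvg].
- exact: L1Z (L1_norm phiL).
- apply: nearW => s n /=; rewrite in_itv/= => sL.
  by rewrite lee_fin fC.
move=> _ _; rewrite -[X in _ --> X]fineK; last exact: integrable_fin_num.
move=> /fine_cvgP[_ H].
have {}H : integ L (f n) @[n --> \oo] --> integ L (fun s => K1 s * phi s) by exact: H.
move/cvgrPdist_le : H => /(_ e e0)[N _ /(_ N (leqnn N))].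
have [_ _] := Hy N; have n0 : 0 < `|y N - x| by rewrite normr_gt0.
rewrite ltNge => /negP + H; apply.
rewrite -(ler_pM2r n0) -normrM in H; apply: le_trans H.
rewrite /f integZ; last by apply: L1B; exact: iK.
rewrite integB; [|exact: iK|exact: iK].
rewrite le_eqVlt; apply/orP; left; apply/eqP; rewrite -normrN; congr `|_|.
by field; exact: yNx.
Unshelve. all: by end_near. Qed.

(** A convolution kernel cut off at the diagonal: the integral up to [x] becomes one over the fixed
    interval [0, L], with [x] only in the integrand. *)
Definition kern k x s := if s <= x then k (x - s) else 0.

Lemma measurable_kern k x : measurable_fun setT k ->
  measurable_fun `[0, L] (kern k x).
Proof.
move=> mk; apply: (@measurable_funS _ _ _ _ setT) => //.
apply: measurable_fun_ifT => //; first exact: measurable_fun_ler.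
by apply: measurableT_comp => //; exact: measurable_funB.
Qed.

Lemma kern_bound k x s B : 0 <= B -> (forall t, 0 <= t <= L -> `|k t| <= B) ->
  0 <= x <= L -> 0 <= s <= L -> `|kern k x s| <= B.
Proof.
move=> B0 kB /andP[x0 xL] /andP[s0 sL]; rewrite /kern; case: ifP => [sx|_].
  by apply: kB; rewrite subr_ge0 sx lerBlDr (le_trans xL)// lerDl.
by rewrite normr0.
Qed.

Lemma continuous_bounded k : continuous k ->
  exists2 B, 0 <= B & forall t, 0 <= t <= L -> `|k t| <= B.
Proof.
move=> kc; have := continuous_compact (continuous_subspaceT kc) (@segment_compact R 0 L).
move=> /compact_bounded[M [_ HM]]; exists (`|M| + 1) => [|t tL].
  by rewrite addr_ge0.
apply: HM; last by exists t => //=; rewrite in_itv.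
by rewrite ltr_pwDr// ler_norm.
Qed.

Definition volterra k phi x := integ L (fun s => kern k x s * phi s).

Lemma L1_kern k phi x : continuous k -> L1 L phi -> 0 <= x <= L ->
  L1 L (fun s => kern k x s * phi s).
Proof.
move=> kc phiL xL; have [B B0 kB] := continuous_bounded kc.
apply: (@L1_bounded_mul _ _ _ _ B) => // [|s sL]; last exact: kern_bound.
by apply: measurable_kern; exact: continuous_measurable_fun.
Qed.

(** The condition [k 0 = 0] makes the cut-off kernel Lipschitz in [x] across the diagonal, so that
    differentiation under the integral produces no boundary term. *)
Lemma isD_volterra k k1 phi x : 0 <= x <= L -> L1 L phi ->
  continuous k -> continuous k1 -> k 0 = 0 ->
  (forall t, 0 <= t <= L -> isD L k t (k1 t)) ->
  isD L (volterra k phi) x (volterra k1 phi x).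
Proof.
move=> xL phiL kc k1c k0 kD.
have [B B0 kB] := continuous_bounded kc; have [C C0 k1C] := continuous_bounded k1c.
have klip := isD_lipschitz L_gt0 C0 kD k1C.
have D0 y s : 0 <= y <= L -> 0 <= s <= L -> s <= y -> 0 <= y - s <= L.
  move=> /andP[y0 yL] /andP[s0 sL] sy.
  by rewrite subr_ge0 sy lerBlDr (le_trans yL)// lerDl.
have L00 : 0 <= (0 : R) <= L by rewrite lexx ltW.
apply: (@isD_integ (kern k) (kern k1 x) phi x (B + C) C) => //.
- by move=> y yL; apply: measurable_kern; exact: continuous_measurable_fun.
- by apply: measurable_kern; exact: continuous_measurable_fun.
- by move=> y s yL sL; apply: le_trans (kern_bound B0 kB yL sL) _; rewrite lerDl.
- by move=> s sL; apply: le_trans (kern_bound C0 k1C xL sL) _; rewrite lerDr.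
- move=> y s yL sL; rewrite /kern; case: (leP s y) => sy; case: (leP s x) => sx.
  + have -> : y - x = (y - s) - (x - s) by ring.
    by apply: klip; exact: D0.
  + rewrite subr0; have := klip 0 (y - s) L00 (D0 _ _ yL sL sy).
    rewrite k0 !subr0 => /le_trans; apply; rewrite ler_wpM2l//.
    by rewrite (ger0_norm (x := y - s)) ?subr_ge0// (le_trans _ (ler_norm _))//; lra.
  + rewrite sub0r normrN; have := klip 0 (x - s) L00 (D0 _ _ xL sL sx).
    rewrite k0 !subr0 => /le_trans; apply; rewrite ler_wpM2l//.
    rewrite (ger0_norm (x := x - s)) ?subr_ge0// distrC (le_trans _ (ler_norm _))//.
    by lra.
  + by rewrite subrr normr0 mulr_ge0.
move=> s sL sNx e e0; have [sx|xs] := leP s x.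
  have {}sx : s < x by rewrite lt_neqAle sNx.
  have [d d0 Hd] := kD _ (D0 _ _ xL sL (ltW sx)) _ e0.
  exists (Num.min d (x - s)) => [|y yL]; first by rewrite lt_min d0 subr_gt0.
  rewrite lt_min => /andP[yd yx].
  have sy : s <= y by move: yx; rewrite ltr_norml => /andP[]; lra.
  rewrite /kern sy (ltW sx); have := Hd (y - s) (D0 _ _ yL sL sy).
  have -> : y - s - (x - s) = y - x by ring.
  exact.
exists (s - x) => [|y yL]; first by rewrite subr_gt0.
move=> yx; have ys : y < s by move: yx; rewrite ltr_norml => /andP[]; lra.
by rewrite /kern (leNgt s y) ys (leNgt s x) xs/= subrr mul0r subr0 normr0 mulr_ge0// ltW.
Qed.

Lemma volterra_cst1 phi x : 0 <= x <= L -> L1 L phi ->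
  volterra (fun=> 1) phi x = primitive phi x.
Proof.
move=> /andP[x0 xL] phiL; rewrite /volterra /primitive /integ.
rewrite [RHS]Rintegral_mkcond [LHS]Rintegral_mkcond; apply: eq_Rintegral => s _.
rewrite !patchE /kern !mem_setE/= !in_itv/=.
case: (leP 0 s) => //= s0; case: (leP s x) => [sx|xs].
  by rewrite (le_trans sx xL) mul1r.
by rewrite mul0r if_same.
Qed.

Lemma volterraD k k' phi x : continuous k -> continuous k' -> L1 L phi ->
  0 <= x <= L ->
  volterra (fun t => k t + k' t) phi x = volterra k phi x + volterra k' phi x.
Proof.
move=> kc kc' phiL xL; rewrite -integD; [|exact: L1_kern|exact: L1_kern].
by apply: integ_eq => s _; rewrite /kern; case: ifP => _; ring.
Qed.

Lemma volterraZ (r : R) k phi x : continuous k -> L1 L phi -> 0 <= x <= L ->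
  volterra (fun t => r * k t) phi x = r * volterra k phi x.
Proof.
move=> kc phiL xL; rewrite -integZ; last exact: L1_kern.
by apply: integ_eq => s _; rewrite /kern; case: ifP => _; ring.
Qed.

(** [F] minus the primitive of [f] is absolutely continuous with derivative 0 almost everywhere,
    hence constant. *)
Lemma integ_isD_ae F f : abs_cont L F -> L1 L f ->
  {ae mu, forall x, x \in `[0, L] -> isD L F x (f x)} ->
  integ L f = F L - F 0.
Proof.
move=> Fac fL FD.
have hac := abs_contB Fac (primitive_abs_cont fL).
have h0 : {ae mu, forall x, x \in `[0, L] ->
    isD L (fun z => F z - primitive f z) x 0}.
  have FF := ae_filter_ringOfSetsType mu.
  apply: (@filterS2 _ _ FF _ _ _ _ FD (primitive_isD_ae fL)) => z H1 H2 zL.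
  by rewrite -(subrr (f z)); apply: isDB; [exact: H1|exact: H2].
have L00 : 0 <= (0 : R) <= L by rewrite lexx ltW.
have LL : 0 <= L <= L by rewrite lexx ltW.
have := abs_cont_isD0_cst L_gt0 hac h0 L00 LL.
have -> : primitive f 0 = 0 by rewrite /primitive set_itv1 Rintegral_set1.
have -> : primitive f L = integ L f by [].
lra.
Qed.

(** A bounded derivative makes [F] Lipschitz, hence absolutely continuous. The explicit integrals of
    the kernels are computed from antiderivatives in this way. *)
Lemma integ_isD F f B : L1 L f -> 0 <= B ->
  (forall x, 0 <= x <= L -> isD L F x (f x)) ->
  (forall x, 0 <= x <= L -> `|f x| <= B) ->
  integ L f = F L - F 0.
Proof.
move=> fL B0 FD fB; apply: integ_isD_ae => //.
  by apply: lipschitz_abs_cont B0 (isD_lipschitz L_gt0 B0 FD fB).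
by apply: aeW => x; rewrite in_itv/=; exact: FD.
Qed.

End volterra.

(** * An L^1 bound for integral operators *)

Section tonelli.
Context {R : realType}.
Variable L : R.
Local Notation mu := (@lebesgue_measure R).

Lemma EFin_integ (f : R -> R) : L1 L f ->
  (integ L f)%:E = (\int[mu]_(x in `[0%R, L]) (f x)%:E)%E.
Proof. by move=> fL; rewrite /integ /Rintegral fineK//; exact: integrable_fin_num. Qed.

Lemma ae_eq_integ (f g : R -> R) : L1 L f -> L1 L g -> L1eq L f g ->
  integ L f = integ L g.
Proof.
move=> fL gL fg; rewrite /integ /Rintegral; congr fine.
apply: ae_eq_integral => //.
- by apply/measurable_EFinP; exact: L1_measurable.
- by apply/measurable_EFinP; exact: L1_measurable.
have FF := ae_filter_ringOfSetsType mu.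
by apply: (@filterS _ _ FF _ _ _ fg) => x H xL; rewrite H.
Qed.

Lemma L1norm_integ (f : R -> R) : L1norm L f = integ L (fun x => `|f x|).
Proof. by []. Qed.

(** Tonelli's theorem exchanges the integrals, so the norm of the operator on L^1 is governed by the
    integrals of [K] over its first variable. *)
Lemma L1norm_integral_le (K : R -> R -> R) (phi : R -> R) (B : R) :
  measurable_fun setT (fun z : R * R => K z.1 z.2) ->
  (forall t s, 0 <= t <= L -> 0 <= s <= L -> 0 <= K t s) ->
  (forall t, 0 <= t <= L -> L1 L (fun s => K t s * phi s)) ->
  (forall s, 0 <= s <= L -> L1 L (K^~ s)) ->
  L1 L (fun t => integ L (fun s => K t s * phi s)) ->
  (forall s, 0 <= s <= L -> integ L (K^~ s) <= B) ->
  L1 L phi ->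
  L1norm L (fun t => integ L (fun s => K t s * phi s)) <= B * L1norm L phi.
Proof.
move=> mK K0 KphiL KL FL KB phiL.
pose phi0 := phi \_ `[0, L]; pose D : set R := `[0, L]%classic.
have mD : measurable D by exact: measurable_itv.
have phi0T := L1_restrict phiL.
have mphi0 : measurable_fun setT phi0 by case/integrableP : phi0T => /measurable_EFinP.
(* The cut-offs extend the double integral to the whole plane, where Tonelli's theorem is applied to
   a nonnegative measurable function. *)
pose H (z : R * R) := (\1_D z.1 * `|K z.1 z.2 * phi0 z.2|)%:E.
have mH : measurable_fun setT H.
  apply/measurable_EFinP/measurable_funM.
    by apply: (measurableT_comp (measurable_indic mD)); exact: measurable_fst.
  apply: measurableT_comp => //; apply: measurable_funM => //.
  by apply: (measurableT_comp mphi0); exact: measurable_snd.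
have H0 z : (0 <= H z)%E by rewrite lee_fin mulr_ge0// indicE.
have inD s : (s \in D) = (0 <= s <= L) by rewrite /D mem_setE in_itv.
rewrite -lee_fin -[L1norm _ _]/(integ L _) EFin_integ; last exact: L1_norm.
pose I t := (\int[mu]_s H (t, s))%E.
have mI : measurable_fun setT I by exact: (@measurable_fun_fubini_tonelli_F _ _ _ _ _ mu H mH H0).
have I0 t : (0 <= I t)%E by exact: integral_ge0.
have FI t : D t -> (`|integ L (fun s => K t s * phi s)|%:E <= I t)%E.
  rewrite /D/= in_itv/= => tL; apply: (@le_trans _ _
    (integ L (fun s => `|K t s * phi s|))%:E).
    by rewrite lee_fin; exact: normr_integ (KphiL t tL).
  rewrite EFin_integ; last by apply: L1_norm; exact: KphiL.
  rewrite integral_mkcond le_eqVlt; apply/orP; left; apply/eqP.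
  apply: eq_integral => s _; rewrite /H/= indicE inD tL mul1r /phi0 !patchE.
  by case: ifP => //; rewrite mulr0 normr0.
apply: (@le_trans _ _ (\int[mu]_(t in D) I t)%E).
  apply: ge0_le_integral => //; last exact: measurable_funTS.
  by apply/measurable_EFinP/measurableT_comp => //; exact: L1_measurable.
apply: (@le_trans _ _ (\int[mu]_t I t)%E).
  by apply: ge0_subset_integral.
rewrite (_ : (\int[mu]_t I t = \int[mu]_s \int[mu]_t H (t, s))%E); last first.
  exact: (@fubini_tonelli _ _ _ _ _ mu mu H mH H0).
apply: (@le_trans _ _ (\int[mu]_s ((B * `|phi0 s|)%:E))%E).
  apply: ge0_le_integral => //.
  - by move=> s _; exact: integral_ge0.
  - exact: (@measurable_fun_fubini_tonelli_G _ _ _ _ _ mu H mH H0).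
  - by apply/measurable_EFinP/measurable_funM => //; exact: measurableT_comp.
  move=> s _; rewrite /H/=; have [|sD] := boolP (s \in D); last first.
    rewrite /phi0 patchE (negPf sD) normr0 mulr0 integral0_eq// => t _.
    by rewrite mulr0 normr0 mulr0.
  rewrite inD => sL; rewrite (_ : (\int[mu]_t _)%E =
      (integ L (fun t => `|phi s| * K t s))%:E).
    rewrite integZ ?lee_fin; last exact: KL.
    by rewrite /phi0 patchE -/D inD sL mulrC ler_wpM2r// KB.
  rewrite EFin_integ; last by apply: L1Z; exact: KL.
  rewrite [RHS]integral_mkcond; apply: eq_integral => t _.
  rewrite indicE /phi0 !patchE -/D (inD s) sL; have [|tD] := boolP (t \in D).
    rewrite inD => tL; rewrite mul1r normrM mulrC; congr (_ * _)%:E.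
    by rewrite ger0_norm// K0.
  by rewrite mul0r.
rewrite -[B * _]/(B * integ L (fun s => `|phi s|)) -integZ; last exact: L1_norm.
rewrite EFin_integ; last by apply: L1Z; exact: L1_norm.
rewrite le_eqVlt; apply/orP; left; apply/eqP.
rewrite [RHS]integral_mkcond; apply: eq_integral => s _.
by rewrite /phi0 !patchE -/D; case: ifP => //; rewrite normr0 mulr0.
Qed.

End tonelli.

(** * The Green function and its potentials *)

Section green_function.
Context {R : realType}.
Variables L a : R.
Hypotheses (L_gt0 : 0 < L) (a_gt0 : 0 < a).
Implicit Types (k phi psi w : R -> R) (x s t : R).
Local Notation mu := (@lebesgue_measure R).
Local Notation r := (Num.sqrt a).

Lemma sqrta_gt0 : 0 < r. Proof. by rewrite sqrtr_gt0. Qed.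

Lemma sqrta_sqr : r * r = a. Proof. by rewrite -expr2 sqr_sqrtr// ltW. Qed.

Lemma sinh_sqrtaL_gt0 : 0 < sinh (r * L).
Proof. by rewrite sinh_gt0// mulr_gt0// sqrta_gt0. Qed.

(* The Green function of [u |-> - u'' + a u] with Dirichlet conditions; the
   second derivative of [\int G(., s) psi(s) ds] is [- \int helm(., s) psi(s) ds]. *)
Definition helm_le x s :=
  sinh (r * x) * sinh (r * (L - s)) / (r * sinh (r * L)).
Definition helm x s := if x <= s then helm_le x s else helm_le s x.

(* [green] is smooth in each variable up to [kern kh], and [kg], [ks], [kc] are
   the successive derivatives of [kh]; of these only [kc] does not vanish at 0,
   hence the jump of the third derivative of [green] along the diagonal. *)
Definition kh t := (a * r)^-1 * sinh (r * t) + (- a^-1) * t.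
Definition kg t := a^-1 * cosh (r * t) - a^-1.
Definition ks t := r^-1 * sinh (r * t).
Definition kc t := cosh (r * t).
(** [alph] and [bet] are the factors in [s] of the branch [x <= s] of [green], in front of [x] and
    of [- sinh (r * x)]. *)
Definition alph s := (L - s) / (a * L).
Definition bet s := sinh (r * (L - s)) / (a * r * sinh (r * L)).

(** For [s < x] the linear parts of the two branches differ by [- (x - s) / a] and the hyperbolic
    parts, by [sinh_exchange], by a multiple of [sinh (r * (x - s))]; together they make [kh]. *)
Lemma greenE x s : green L a x s = x * alph s - sinh (r * x) * bet s + kern kh x s.
Proof.
have r0 := sqrta_gt0; have S0 := sinh_sqrtaL_gt0.
have ex := sinh_exchange r L x s.
rewrite /green /kern /green_le /alph /bet /kh.
case: (ltgtP x s) => [xs|sx|->].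
- by field; rewrite !gt_eqF.
- have -> : sinh (r * (x - s)) =
    (sinh (r * x) * sinh (r * (L - s)) - sinh (r * s) * sinh (r * (L - x))) /
    sinh (r * L) by rewrite ex mulfK// gt_eqF.
  by field; rewrite !gt_eqF.
- by rewrite !subrr !mulr0 sinh0; field; rewrite !gt_eqF.
Qed.

Lemma helmE x s : helm x s = a * sinh (r * x) * bet s - kern ks x s.
Proof.
have r0 := sqrta_gt0; have S0 := sinh_sqrtaL_gt0.
have ex := sinh_exchange r L x s.
rewrite /helm /kern /helm_le /bet /ks.
case: (ltgtP x s) => [xs|sx|->].
- by field; rewrite !gt_eqF.
- have -> : sinh (r * (x - s)) =
    (sinh (r * x) * sinh (r * (L - s)) - sinh (r * s) * sinh (r * (L - x))) /
    sinh (r * L) by rewrite ex mulfK// gt_eqF.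
  by field; rewrite !gt_eqF.
- by rewrite !subrr !mulr0 sinh0; field; rewrite !gt_eqF.
Qed.

Lemma helm_sym x s : helm x s = helm s x.
Proof. by rewrite /helm; case: (ltgtP x s) => // ->. Qed.

Lemma green_sym x s : green L a x s = green L a s x.
Proof. by rewrite /green; case: (ltgtP x s) => // ->. Qed.

Lemma helm_ge0 x s : 0 <= x <= L -> 0 <= s <= L -> 0 <= helm x s.
Proof.
move=> /andP[x0 xL] /andP[s0 sL]; have r0 := ltW sqrta_gt0.
have S0 := ltW sinh_sqrtaL_gt0.
have sx y : 0 <= y -> 0 <= sinh (r * y).
  by move=> y0; apply: sinh_ge0; exact: mulr_ge0.
rewrite /helm /helm_le; case: ifP => _; apply: divr_ge0; apply: mulr_ge0 => //;
  by apply: sx; rewrite ?subr_ge0.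
Qed.

Lemma green_ge0 x s : 0 <= x <= L -> 0 <= s <= L -> 0 <= green L a x s.
Proof.
move=> xL sL; rewrite /green.
suff H t z : 0 <= t -> t <= z -> z <= L -> 0 <= green_le L a t z.
  move: xL sL => /andP[x0 xL] /andP[s0 sL].
  by case: (leP x s) => [xs|/ltW sx]; apply: H.
move=> t0 tz zL; rewrite /green_le subr_ge0.
have r0 := sqrta_gt0; have S0 := sinh_sqrtaL_gt0.
have Lz : 0 <= L - z by rewrite subr_ge0.
have tzL : t + (L - z) <= L by lra.
have aL0 : 0 < a * L by exact: mulr_gt0.
have aS0 : 0 < a * r * sinh (r * L) by rewrite pmulr_rgt0// mulr_gt0.
have := ler_wpM2l (ltW a_gt0) (sinh_product_le (ltW r0) t0 Lz tzL).
by rewrite ler_pdivrMr// (mulrAC _ (a * L)^-1) ler_pdivlMr//; lra.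
Qed.

Lemma green_helm x s : green L a x s =
  ((if x <= s then x * (L - s) else s * (L - x)) / L - helm x s) / a.
Proof.
have r0 := sqrta_gt0; have S0 := sinh_sqrtaL_gt0.
rewrite /green /helm /green_le /helm_le; case: ifP => _;
  by field; rewrite !gt_eqF.
Qed.

(** The sign of [green] puts [helm] below the kernel of [- u''], which is at most [L]. This
    pointwise bound is the source of the uniform estimate of w''. *)
Lemma helm_le_L x s : 0 <= x <= L -> 0 <= s <= L -> helm x s <= L.
Proof.
move=> xL sL; have := green_ge0 xL sL; rewrite green_helm.
rewrite pmulr_lge0 ?invr_gt0// subr_ge0 => /le_trans; apply.
move: xL sL => /andP[x0 xL] /andP[s0 sL].
rewrite ler_pdivrMr//; case: ifP => _; apply: ler_pM; lra.
Qed.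

Lemma continuous_kh : continuous kh.
Proof.
move=> t; apply: cvgD; first by apply: cvgM; [exact: cvg_cst|exact: continuous_sinh].
by apply: cvgM; [exact: cvg_cst|exact: cvg_id].
Qed.

Lemma continuous_kg : continuous kg.
Proof.
move=> t; apply: cvgB; last exact: cvg_cst.
by apply: cvgM; [exact: cvg_cst|exact: continuous_cosh].
Qed.

Lemma continuous_ks : continuous ks.
Proof. by move=> t; apply: cvgM; [exact: cvg_cst|exact: continuous_sinh]. Qed.

Lemma continuous_kc : continuous kc.
Proof. exact: continuous_cosh. Qed.

Lemma continuous_alph : continuous alph.
Proof.
move=> t; apply: cvgM; last exact: cvg_cst.
by apply: cvgB; [exact: cvg_cst|exact: cvg_id].
Qed.

Lemma continuous_bet : continuous bet.
Proof.
move=> t; apply: cvgM; last exact: cvg_cst.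
apply: (@continuous_comp _ _ _ (fun s => L - s) (fun s => sinh (r * s))).
  by apply: cvgB; [exact: cvg_cst|exact: cvg_id].
exact: continuous_sinh.
Qed.

Lemma L1_continuous_mul k phi : continuous k -> L1 L phi ->
  L1 L (fun s => k s * phi s).
Proof.
move=> kc phiL; have [B B0 kB] := continuous_bounded L kc.
apply: (@L1_bounded_mul _ _ _ _ B) => //.
by apply: measurable_funTS; exact: continuous_measurable_fun.
Qed.

Definition coefA psi := integ L (fun s => alph s * psi s).
Definition coefB psi := integ L (fun s => bet s * psi s).

(** The Green potential of [psi] and its first three derivatives, with all dependence on the
    diagonal confined to the Volterra term. Indices beyond 3 repeat the third derivative. *)
Definition dgreen psi (j : nat) x : R := match j with
  | 0 => x * coefA psi - sinh (r * x) * coefB psi + volterra L kh psi x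
  | 1 => coefA psi - r * cosh (r * x) * coefB psi + volterra L kg psi x
  | 2 => - (a * sinh (r * x) * coefB psi) + volterra L ks psi x
  | _ => - (a * r * cosh (r * x) * coefB psi) + volterra L kc psi x
  end.

Section potential.
Variable psi : R -> R.
Hypothesis psiL : L1 L psi.

Lemma L1_green x : 0 <= x <= L -> L1 L (fun s => green L a x s * psi s).
Proof.
move=> xL.
have := L1D (L1B (L1Z x (L1_continuous_mul continuous_alph psiL))
  (L1Z (sinh (r * x)) (L1_continuous_mul continuous_bet psiL)))
  (L1_kern continuous_kh psiL xL).
by apply: L1_eq => s _; rewrite greenE; ring.
Qed.

Lemma L1_helm x : 0 <= x <= L -> L1 L (fun s => helm x s * psi s).
Proof.
move=> xL.
have := L1B (L1Z (a * sinh (r * x)) (L1_continuous_mul continuous_bet psiL))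
  (L1_kern continuous_ks psiL xL).
by apply: L1_eq => s _; rewrite helmE; ring.
Qed.

Lemma integ_green x : 0 <= x <= L ->
  integ L (fun s => green L a x s * psi s) = dgreen psi 0 x.
Proof.
move=> xL; have iA := L1_continuous_mul continuous_alph psiL.
have iB := L1_continuous_mul continuous_bet psiL.
rewrite /dgreen /coefA /coefB /volterra -!integZ// -integB; [|exact: L1Z|exact: L1Z].
rewrite -integD; [|by apply: L1B; exact: L1Z|exact: L1_kern continuous_kh psiL xL].
by apply: integ_eq => s _; rewrite greenE; ring.
Qed.

Lemma integ_helm x : 0 <= x <= L ->
  integ L (fun s => helm x s * psi s) = - dgreen psi 2 x.
Proof.
move=> xL; have iB := L1_continuous_mul continuous_bet psiL.
rewrite /dgreen /coefB /volterra opprD opprK -integZ// -integB; last first.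
- exact: L1_kern continuous_ks psiL xL.
- exact: L1Z.
by apply: integ_eq => s _; rewrite helmE; ring.
Qed.

Lemma isD_kh x : isD L kh x (kg x).
Proof.
have := isDD (isDZ (a * r)^-1 (isD_sinh L r x)) (isDZ (- a^-1) (isD_id L x)).
by apply: isD_val; rewrite /kg; have r0 := sqrta_gt0; field; rewrite !gt_eqF.
Qed.

Lemma isD_kg x : isD L kg x (ks x).
Proof.
have := isDB (isDZ a^-1 (isD_cosh L r x)) (isD_cst L a^-1 x).
by apply: isD_val; rewrite /ks subr0 -{1}sqrta_sqr; have r0 := sqrta_gt0; field; rewrite gt_eqF.
Qed.

Lemma isD_ks x : isD L ks x (kc x).
Proof.
have := isDZ r^-1 (isD_sinh L r x).
by apply: isD_val; rewrite /kc; have r0 := sqrta_gt0; field; rewrite gt_eqF.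
Qed.

Lemma isD_dgreen j x : (j < 3)%N -> 0 <= x <= L ->
  isD L (dgreen psi j) x (dgreen psi j.+1 x).
Proof.
have r0 := sqrta_gt0.
have kh0 : kh 0 = 0 by rewrite /kh !mulr0 sinh0 mulr0 addr0.
have kg0 : kg 0 = 0 by rewrite /kg mulr0 cosh0 mulr1 subrr.
have ks0 : ks 0 = 0 by rewrite /ks mulr0 sinh0 mulr0.
have S := isDZ (coefB psi) (isD_sinh L r x); have C := isDZ (coefB psi) (isD_cosh L r x).
case: j => [|[|[|//]]] _ xL.
- have V := isD_volterra L_gt0 xL psiL continuous_kh continuous_kg kh0 (fun t _ => isD_kh t).
  have H := isDD (isDB (isDZ (coefA psi) (isD_id L x)) S) V.
  apply: isD_val (isD_eq xL _ H); first by rewrite /=; ring.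
  by move=> y _; rewrite /=; ring.
- have V := isD_volterra L_gt0 xL psiL continuous_kg continuous_ks kg0 (fun t _ => isD_kg t).
  have H := isDD (isDB (isD_cst L (coefA psi) x) (isDZ r C)) V.
  (* [a] is replaced by the square of its root, a relation that [ring] cannot see by itself. *)
  apply: isD_val (isD_eq xL _ H); first by have r2 := sqrta_sqr; rewrite /=; set q := r in r2 *; rewrite -r2; ring.
  by move=> y _; rewrite /=; ring.
- have V := isD_volterra L_gt0 xL psiL continuous_ks continuous_kc ks0 (fun t _ => isD_ks t).
  have H := isDD (isDZ (- a) S) V.
  apply: isD_val (isD_eq xL _ H); first by rewrite /=; ring.
  by move=> y _; rewrite /=; ring.
Qed.

(* [cosh = 1 + (cosh - 1)], where the kernel 1 contributes [primitive psi] and the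
   kernel [cosh - 1] vanishes at 0. *)
Definition smooth_dgreen3 x : R :=
  - (a * r * cosh (r * x) * coefB psi) + volterra L (fun t => cosh (r * t) - 1) psi x.

Lemma dgreen3E x : 0 <= x <= L ->
  dgreen psi 3 x = smooth_dgreen3 x + primitive psi x.
Proof.
move=> xL; rewrite /dgreen /smooth_dgreen3 -addrA; congr (_ + _).
rewrite -(volterra_cst1 xL psiL) -volterraD//.
- by apply: integ_eq => s _; rewrite /kern /kc subrK.
- by move=> t; apply: cvgB; [exact: continuous_cosh|exact: cvg_cst].
- by move=> t; exact: cvg_cst.
Qed.

Lemma isD_smooth_dgreen3 x : 0 <= x <= L ->
  isD L smooth_dgreen3 x (a * dgreen psi 2 x).
Proof.
move=> xL; have r0 := sqrta_gt0.
have c1 : continuous (fun t => cosh (r * t) - 1).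
  by move=> t; apply: cvgB; [exact: continuous_cosh|exact: cvg_cst].
have c2 : continuous (fun t => r * sinh (r * t)).
  by move=> t; apply: cvgM; [exact: cvg_cst|exact: continuous_sinh].
have c0 : cosh (r * 0) - 1 = 0 by rewrite mulr0 cosh0 subrr.
have V := isD_volterra L_gt0 xL psiL c1 c2 c0
  (fun t _ => isD_val (subr0 _) (isDB (isD_cosh L r t) (isD_cst L 1 t))).
have H := isDD (isDZ (- (a * r * coefB psi)) (isD_cosh L r x)) V.
apply: isD_val (isD_eq xL _ H); last by move=> y _; rewrite /smooth_dgreen3; ring.
have -> : volterra L (fun t => r * sinh (r * t)) psi x = a * volterra L ks psi x.
  rewrite -volterraZ//; last exact: continuous_ks.
  apply: integ_eq => s _; congr (_ * _); rewrite /kern; case: ifP => // _.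
  by have r2 := sqrta_sqr; rewrite /ks; set q := r in r0 r2 *; rewrite -r2; field; rewrite gt_eqF.
by have r2 := sqrta_sqr; rewrite /=; set q := r in r2 *; rewrite -r2; ring.
Qed.

Lemma continuous_dgreen2 : {within `[0, L], continuous (dgreen psi 2)}.
Proof.
by apply: isD_continuous => x xL; exists (dgreen psi 3 x); exact: isD_dgreen.
Qed.

(** The third derivative is the sum of a function with bounded derivative, hence Lipschitz, and of
    the primitive of [psi]. *)
Lemma abs_cont_dgreen3 : abs_cont L (dgreen psi 3).
Proof.
have c2 : {within `[0, L], continuous (fun x => a * dgreen psi 2 x)}.
  apply: isD_continuous => x xL; exists (a * dgreen psi 3 x).
  by apply: isDZ; exact: isD_dgreen.
have [B B0 HB] : exists2 B, 0 <= B &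
    forall t, 0 <= t <= L -> `|a * dgreen psi 2 t| <= B.
  have := continuous_compact c2 (@segment_compact R 0 L).
  move=> /compact_bounded[M [_ HM]]; exists (`|M| + 1) => [|t tL].
    by rewrite addr_ge0.
  apply: HM; last by exists t => //=; rewrite in_itv.
  by rewrite ltr_pwDr// ler_norm.
have := lipschitz_abs_cont B0 (isD_lipschitz L_gt0 B0 isD_smooth_dgreen3 HB).
move=> /abs_contD/(_ (primitive_abs_cont psiL)) H e e0.
have [d d0 Hd] := H e e0; exists d => // n u v uv tuv sd.
rewrite (eq_bigr (fun i => `|smooth_dgreen3 (v i) + primitive psi (v i) -
  (smooth_dgreen3 (u i) + primitive psi (u i))|)); first exact: Hd.
move=> i _; have [u0 uvi vL] := uv i.
by rewrite !dgreen3E// ?u0 ?vL ?(le_trans u0 uvi) ?(le_trans uvi vL).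
Qed.

Lemma dgreen3_isD_ae :
  {ae mu, forall x, x \in `[0, L] -> isD L (dgreen psi 3) x (a * dgreen psi 2 x + psi x)}.
Proof.
have FF := ae_filter_ringOfSetsType mu.
apply: (@filterS _ _ FF _ _ _ (primitive_isD_ae psiL)) => x H xL.
have xL' : 0 <= x <= L by move: xL; rewrite in_itv.
apply: isD_eq xL' _ (isDD (isD_smooth_dgreen3 xL') (H xL)) => y yL.
by rewrite dgreen3E.
Qed.

Lemma W41_green w : (forall x, 0 <= x <= L -> w x = dgreen psi 0 x) -> W41 L w.
Proof.
move=> wE; have E := isD_chain_nderiv L_gt0 wE isD_dgreen.
split.
- by apply: isD_chain_Ck wE isD_dgreen _ => //; apply: abs_cont_continuous abs_cont_dgreen3.
- move=> e e0; have [d d0 Hd] := abs_cont_dgreen3 e0; exists d => // n u v uv tuv sd.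
  rewrite (eq_bigr (fun i => `|dgreen psi 3 (v i) - dgreen psi 3 (u i)|)).
    exact: Hd.
  move=> i _; have [u0 uvi vL] := uv i.
  by rewrite !(E 3%N)// ?u0 ?vL ?(le_trans u0 uvi) ?(le_trans uvi vL).
- exists (fun x => a * dgreen psi 2 x + psi x).
    by apply: L1D => //; apply: L1Z; apply: continuous_L1 continuous_dgreen2.
  have FF := ae_filter_ringOfSetsType mu.
  apply: (@filterS _ _ FF _ _ _ dgreen3_isD_ae) => x H xL.
  have xL' : 0 <= x <= L by move: xL; rewrite in_itv.
  have H3 : isD L (nderiv L 3 w) x (a * dgreen psi 2 x + psi x).
    by apply: isD_eq xL' _ (H xL) => y yL; rewrite (E 3%N).
  by split; [exact: isD_has_deriv H3|exact: isD_deriv H3].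
Qed.

Lemma nderiv2_green w : (forall x, 0 <= x <= L -> w x = dgreen psi 0 x) ->
  forall x, 0 <= x <= L -> nderiv L 2 w x = dgreen psi 2 x.
Proof. by move=> wE x xL; apply: (isD_chain_nderiv L_gt0 wE isD_dgreen). Qed.

Lemma nderiv4_green w : (forall x, 0 <= x <= L -> w x = dgreen psi 0 x) ->
  {ae mu, forall x, x \in `[0, L] -> nderiv L 4 w x = a * dgreen psi 2 x + psi x}.
Proof.
move=> wE; have E := isD_chain_nderiv L_gt0 wE isD_dgreen.
have FF := ae_filter_ringOfSetsType mu.
apply: (@filterS _ _ FF _ _ _ dgreen3_isD_ae) => x H xL.
have xL' : 0 <= x <= L by move: xL; rewrite in_itv.
have H3 : isD L (nderiv L 3 w) x (a * dgreen psi 2 x + psi x).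
  by apply: isD_eq xL' _ (H xL) => y yL; rewrite (E 3%N).
exact: isD_deriv H3.
Qed.

End potential.

End green_function.

(** * Potentials of a constant load *)

Section constant_load.
Context {R : realType}.
Variables L a : R.
Hypotheses (L_gt0 : 0 < L) (a_gt0 : 0 < a).
Implicit Types (k phi psi : R -> R) (x s t : R).
Local Notation mu := (@lebesgue_measure R).
Local Notation r := (Num.sqrt a).
Local Notation T := (tanh (Num.sqrt a * L / 2)).

Lemma isD_reflect (l : R) k x d : isD l k (l - x) d -> isD l (fun s => k (l - s)) x (- d).
Proof.
move=> H e e0; have [d' d0 Hd] := H e e0; exists d' => // y /andP[y0 yl] yx.
have E : l - y - (l - x) = - (y - x) by ring.
have := Hd (l - y); rewrite E normrN => /(_ _ yx).
by rewrite mulrN mulNr; apply; apply/andP; split; lra.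
Qed.

Lemma continuous_reflect (l : R) k : continuous k -> continuous (fun s => k (l - s)).
Proof.
move=> kc t; apply: (@continuous_comp _ _ _ (fun s => l - s) k).
  by apply: cvgB; [exact: cvg_cst|exact: cvg_id].
exact: kc.
Qed.

(** The derivative of [K] is assumed relative to every interval [0, l], because the fundamental
    theorem is applied on [0, x] after the reflection [s] to [x - s]. *)
Lemma volterra_one k K x : continuous k -> (forall l t, isD l K t (k t)) ->
  K 0 = 0 -> 0 <= x <= L -> volterra L k (fun=> 1) x = K x.
Proof.
move=> kc KD K0 /andP[x0 xL].
have -> : volterra L k (fun=> 1) x = integ x (fun s => k (x - s)).
  rewrite /volterra /integ [RHS]Rintegral_mkcond [LHS]Rintegral_mkcond.
  apply: eq_Rintegral => s _; rewrite !patchE /kern !mem_setE/= !in_itv/=.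
  case: (leP 0 s) => //= s0; case: (leP s x) => [sx|xs].
    by rewrite (le_trans sx xL) mulr1.
  by rewrite mul0r if_same.
have [x_eq0|xN0] := eqVneq x 0.
  by rewrite x_eq0 K0 /integ set_itv1 Rintegral_set1.
have {xN0}x1 : 0 < x by rewrite lt_neqAle eq_sym xN0.
have kc' := @continuous_reflect x k kc.
have [B B0 kB] := continuous_bounded x kc'.
rewrite (@integ_isD _ x x1 (fun s => - 1 * K (x - s)) _ B)//.
- by rewrite subrr subr0 K0 mulr0 sub0r mulN1r opprK.
- by apply: continuous_L1; exact: continuous_subspaceT.
move=> t _; apply: isD_val (isDZ (-1) (isD_reflect (KD _ _))).
by rewrite mulrNN mul1r.
Qed.

Lemma tanh_halfE : T = (cosh (r * L) - 1) / sinh (r * L).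
Proof. by rewrite tanh_half// mulr_gt0// sqrta_gt0. Qed.

Lemma tanh_half_le1 : T <= 1.
Proof.
rewrite tanh_halfE ler_pdivrMr ?sinh_sqrtaL_gt0// mul1r lerBlDr -lerBlDl.
have -> : cosh (r * L) - sinh (r * L) = expR (- (r * L)).
  by rewrite /cosh /sinh; field.
by rewrite -[leRHS]expR0 ler_expR oppr_le0 mulr_ge0// ltW// sqrta_gt0.
Qed.

Lemma coefA_one : coefA L a (fun=> 1) = L / (2 * a).
Proof.
have ac : continuous (alph L a) := @continuous_alph _ L a.
have [B B0 aB] := continuous_bounded L ac.
have FD x : 0 <= x <= L ->
    isD L (fun s => (a * L)^-1 * (L * s - 2^-1 * s ^+ 2)) x (alph L a x).
  move=> xL; have := isDZ (a * L)^-1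
    (isDB (isDZ L (isD_id L x)) (isDZ 2^-1 (isD_sqr L x))).
  by apply: isD_val; rewrite /alph; field; rewrite !gt_eqF.
rewrite /coefA (integ_eq (g := alph L a)); last by move=> s _; rewrite mulr1.
rewrite (@integ_isD _ L L_gt0 _ _ B _ B0 FD aB).
  by field; rewrite !gt_eqF.
by apply: continuous_L1; exact: continuous_subspaceT.
Qed.

Lemma coefB_one : coefB L a (fun=> 1) = T / a ^+ 2.
Proof.
have r0 := sqrta_gt0 a_gt0; have S0 := sinh_sqrtaL_gt0 L_gt0 a_gt0.
have bc : continuous (bet L a) := @continuous_bet _ L a.
have [B B0 bB] := continuous_bounded L bc.
have FD x : 0 <= x <= L ->
    isD L (fun s => - (a * r * r * sinh (r * L))^-1 * cosh (r * (L - s))) x (bet L a x).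
  move=> xL; have := isDZ (- (a * r * r * sinh (r * L))^-1)
    (isD_reflect (isD_cosh L r (L - x))).
  by apply: isD_val; rewrite /bet; field; rewrite !gt_eqF.
rewrite /coefB (integ_eq (g := bet L a)); last by move=> s _; rewrite mulr1.
rewrite (@integ_isD _ L L_gt0 _ _ B _ B0 FD bB).
  rewrite tanh_halfE subrr subr0 mulr0 cosh0 -(mulrA a) sqrta_sqr//.
  by field; rewrite !gt_eqF.
by apply: continuous_L1; exact: continuous_subspaceT.
Qed.

(** The solution of [- u'' + a u = 1] that vanishes at 0 and [L]. *)
Definition helm1 x := (1 - cosh (r * x) + T * sinh (r * x)) / a.

Lemma integ_helm1 x : 0 <= x <= L -> integ L (helm L a x) = helm1 x.
Proof.
move=> xL; have r0 := sqrta_gt0 a_gt0.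
have kg0 : kg a 0 = 0 by rewrite /kg mulr0 cosh0 mulr1 subrr.
rewrite (integ_eq (g := fun s => helm L a x s * 1)); last by move=> s _; rewrite mulr1.
rewrite (integ_helm L_gt0 a_gt0 (L1_cst L 1) xL) /= coefB_one.
rewrite (volterra_one (@continuous_ks _ a) (fun l t => isD_kg l a_gt0 t) kg0 xL).
by rewrite /kg /helm1; field; rewrite gt_eqF.
Qed.

Lemma integ_green1 x : 0 <= x <= L ->
  integ L (green L a x) = (x * (L - x) / 2 - helm1 x) / a.
Proof.
move=> xL; have r0 := sqrta_gt0 a_gt0.
pose K t := (a ^+ 2)^-1 * cosh (r * t) - (a ^+ 2)^-1 - (2 * a)^-1 * t ^+ 2.
have K0 : K 0 = 0.
  by rewrite /K mulr0 cosh0 mulr1 subrr expr0n mulr0 subr0.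
have KD l t : isD l K t (kh a t).
  have := isDB (isDB (isDZ (a ^+ 2)^-1 (isD_cosh l r t)) (isD_cst l (a ^+ 2)^-1 t))
    (isDZ (2 * a)^-1 (isD_sqr l t)).
  apply: isD_val; rewrite /kh; have r2 := sqrta_sqr a_gt0.
  have -> : (a * r)^-1 = r / (a * a) by set q := r in r0 r2 *; rewrite -r2; field; rewrite !gt_eqF.
  by field; rewrite gt_eqF.
rewrite (integ_eq (g := fun s => green L a x s * 1)); last by move=> s _; rewrite mulr1.
rewrite (integ_green L_gt0 a_gt0 (L1_cst L 1) xL) /= coefB_one coefA_one.
rewrite (volterra_one (@continuous_kh _ a) KD K0 xL).
by rewrite /K /helm1; field; rewrite gt_eqF.
Qed.

Lemma helm1_ge0 x : 0 <= x <= L -> 0 <= helm1 x.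
Proof.
move=> xL; rewrite -integ_helm1//; apply: Rintegral_ge0 => s /=.
by rewrite in_itv/= => sL; exact: helm_ge0.
Qed.

Lemma helm1_le x : 0 <= x <= L -> helm1 x <= a^-1.
Proof.
move=> /andP[x0 _]; rewrite /helm1 ler_pdivrMr// mulVf ?gt_eqF//.
have s0 : 0 <= sinh (r * x) by rewrite sinh_ge0// mulr_ge0// ltW// sqrta_gt0.
have := ler_wpM2r s0 tanh_half_le1; have := sinh_le_cosh (r * x); lra.
Qed.

(** The parabola [x * (L - x) / 2] has maximum [L ^+ 2 / 8] at the midpoint, and the nonnegative
    [helm1] is dropped. *)
Lemma integ_green1_le x : 0 <= x <= L -> integ L (green L a x) <= L ^+ 2 / (8 * a).
Proof.
move=> xL; rewrite integ_green1// invfM mulrA ler_wpM2r ?invr_ge0 ?(ltW a_gt0)//.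
have := helm1_ge0 xL; have := sqr_ge0 (x - L / 2); lra.
Qed.

Lemma continuous_helm1 : continuous helm1.
Proof.
move=> t; apply: cvgM; last exact: cvg_cst.
apply: cvgD; first by apply: cvgB; [exact: cvg_cst|exact: continuous_cosh].
by apply: cvgM; [exact: cvg_cst|exact: continuous_sinh].
Qed.

Lemma L1_helm1 : L1 L helm1.
Proof.
by apply: continuous_L1; apply: continuous_subspaceT; exact: continuous_helm1.
Qed.

Lemma integ_integ_helm1 : integ L helm1 = (L - 2 / r * T) / a.
Proof.
have r0 := sqrta_gt0 a_gt0; have S0 := sinh_sqrtaL_gt0 L_gt0 a_gt0.
have [B B0 HB] := continuous_bounded L continuous_helm1.
have FD x : 0 <= x <= L -> isD L (fun s => a^-1 * ((s - r^-1 * sinh (r * s)) +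
    T / r * cosh (r * s))) x (helm1 x).
  move=> xL; have := isDZ a^-1 (isDD (isDB (isD_id L x)
    (isDZ r^-1 (isD_sinh L r x))) (isDZ (T / r) (isD_cosh L r x))).
  by apply: isD_val; rewrite /helm1; field; rewrite !gt_eqF.
rewrite (@integ_isD _ L L_gt0 _ _ B L1_helm1 B0 FD HB) mulr0 sinh0 cosh0 tanh_halfE.
have C2 : cosh (r * L) * cosh (r * L) = 1 + sinh (r * L) * sinh (r * L).
  by rewrite -!expr2 -(cosh2_sinh2 (r * L)) subrK.
move: (sinh (r * L)) (cosh (r * L)) S0 C2 => S C S0 C2.
(* The relation between [cosh] and [sinh] is used up here, so that a rational identity in two free
   variables remains. *)
have SN : S * S = C * C - 1 by rewrite C2; ring.
have -> : r^-1 * S = r^-1 * ((C * C - 1) / S).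
  by rewrite -SN mulfK// gt_eqF.
by field; rewrite !gt_eqF.
Qed.

Lemma L1_integ_green : L1 L (fun x => integ L (green L a x)).
Proof.
have gc : continuous (fun x => (x * (L - x) / 2 - helm1 x) / a).
  move=> t; apply: cvgM; last exact: cvg_cst.
  apply: cvgB; last exact: continuous_helm1.
  apply: cvgM; last exact: cvg_cst.
  by apply: cvgM; [exact: cvg_id|apply: cvgB; [exact: cvg_cst|exact: cvg_id]].
have := continuous_L1 (continuous_subspaceT gc : {within `[0, L], continuous _}).
by apply: L1_eq => x xL; rewrite integ_green1.
Qed.

Lemma integ_integ_green : integ L (fun x => integ L (green L a x)) =
  (L ^+ 3 / 12 - integ L helm1) / a.
Proof.
have qc : continuous (fun x : R => x * (L - x) / 2).
  move=> t; apply: cvgM; last exact: cvg_cst.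
  by apply: cvgM; [exact: cvg_id|apply: cvgB; [exact: cvg_cst|exact: cvg_id]].
have qL := continuous_L1 (continuous_subspaceT qc : {within `[0, L], continuous _}).
have [B B0 HB] := continuous_bounded L qc.
have FD x : 0 <= x <= L ->
    isD L (fun s => L / 4 * s ^+ 2 - 6^-1 * s ^+ 3) x (x * (L - x) / 2).
  move=> xL; have := isDB (isDZ (L / 4) (isD_sqr L x)) (isDZ 6^-1 (isD_cube xL)).
  by apply: isD_val; field.
rewrite (integ_eq (g := fun x => a^-1 * (x * (L - x) / 2 - helm1 x))).
  rewrite integZ; last by apply: L1B => //; exact: L1_helm1.
  rewrite integB//; last exact: L1_helm1.
  rewrite (@integ_isD _ L L_gt0 _ _ B qL B0 FD HB).
  by field; rewrite gt_eqF.
by move=> x xL; rewrite integ_green1// mulrC.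
Qed.

End constant_load.

(** * The linear nonlocal problem *)

Section linear_problem.
Context {R : realType}.
Variables L a c : R.
Hypotheses (L_gt0 : 0 < L) (a_gt0 : 0 < a) (c_gt0 : 0 < c).
Implicit Types (k phi psi w : R -> R) (x s t : R).
Local Notation mu := (@lebesgue_measure R).
Local Notation r := (Num.sqrt a).
Local Notation M := (constM L a c).
Local Notation N := (constN L a c).

Lemma powR52 : a `^ (5 / 2) = a ^+ 2 * r.
Proof.
have -> : 5 / 2 = 2%:R + 2^-1 :> R by field.
rewrite powRD; last by rewrite (gt_eqF a_gt0) implybT.
by rewrite powR_mulrn ?(ltW a_gt0)// powR12_sqrt// ltW.
Qed.

Lemma constME : M = 1 + c * integ L (fun x => integ L (green L a x)).
Proof.
rewrite integ_integ_green// integ_integ_helm1// /constM powR52.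
by have r0 := sqrta_gt0 a_gt0; field; rewrite !gt_eqF.
Qed.

(** This is how [N] arises: in the bound of w'' the density contributes [1 / a] and the constant
    load [c * L ^+ 2 / (8 * a * M)] times the integral of [helm1]; over the denominator [a * M] the
    sum is [N]. *)
Lemma constNE : N = M + c * (L ^+ 2 / 8) * integ L (helm1 L a).
Proof.
rewrite integ_integ_helm1// /constN /constM powR52.
have r0 := sqrta_gt0 a_gt0; have r2 := sqrta_sqr a_gt0.
set q := Num.sqrt a in r0 r2 *; move: (tanh _) => T.
by rewrite -r2; field; rewrite !gt_eqF.
Qed.

Lemma constM_ge1 : 1 <= M.
Proof.
rewrite constME lerDl mulr_ge0 ?(ltW c_gt0)//; apply: Rintegral_ge0 => x /=.
rewrite in_itv/= => xL; apply: Rintegral_ge0 => s /=.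
by rewrite in_itv/= => sL; exact: green_ge0.
Qed.

Lemma constM_gt0 : 0 < M. Proof. exact: lt_le_trans ltr01 constM_ge1. Qed.

Lemma integ_helm1_ge0 : 0 <= integ L (helm1 L a).
Proof. by apply: Rintegral_ge0 => x /=; rewrite in_itv/=; exact: helm1_ge0. Qed.

Lemma constN_gt0 : 0 < N.
Proof.
rewrite constNE ltr_pwDl ?constM_gt0// mulr_ge0 ?integ_helm1_ge0//.
by rewrite mulr_ge0 ?(ltW c_gt0)// divr_ge0// sqr_ge0.
Qed.

Definition greenI phi x := integ L (fun s => green L a x s * phi s).
Definition helmI phi x := integ L (fun s => helm L a x s * phi s).
Definition greenII phi := integ L (greenI phi).

Lemma measurable_kern2 k : continuous k ->
  measurable_fun setT (fun z : R * R => kern k z.1 z.2).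
Proof.
move=> kc; apply: measurable_fun_ifT => //.
  by apply: measurable_fun_ler; [exact: measurable_snd|exact: measurable_fst].
apply: (@measurableT_comp _ _ _ _ _ _ k); first exact: continuous_measurable_fun.
by apply: measurable_funB; [exact: measurable_fst|exact: measurable_snd].
Qed.

Lemma measurable_prod2 (f g : R -> R) : continuous f -> continuous g ->
  measurable_fun setT (fun z : R * R => f z.1 * g z.2).
Proof.
move=> fc gc; apply: measurable_funM.
  apply: (@measurableT_comp _ _ _ _ _ _ f); last exact: measurable_fst.
  exact: continuous_measurable_fun.
apply: (@measurableT_comp _ _ _ _ _ _ g); last exact: measurable_snd.
exact: continuous_measurable_fun.
Qed.

Lemma measurable_green : measurable_fun setT (fun z : R * R => green L a z.1 z.2).
Proof.
rewrite (_ : (fun _ => _) = fun z : R * R => z.1 * alph L a z.2 -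
    sinh (r * z.1) * bet L a z.2 + kern (kh a) z.1 z.2); last first.
  by apply/funext => z; rewrite greenE.
apply: measurable_funD; last by apply: measurable_kern2; exact: continuous_kh.
apply: measurable_funB.
  apply: (measurable_prod2 (f := fun x => x)); last exact: continuous_alph.
  by move=> t; exact: cvg_id.
apply: (measurable_prod2 (f := fun x => sinh (r * x))); last exact: continuous_bet.
exact: continuous_sinh.
Qed.

Lemma measurable_helm : measurable_fun setT (fun z : R * R => helm L a z.1 z.2).
Proof.
rewrite (_ : (fun _ => _) = fun z : R * R => a * sinh (r * z.1) * bet L a z.2
    - kern (ks a) z.1 z.2); last first.
  by apply/funext => z; rewrite helmE.
apply: measurable_funB; last by apply: measurable_kern2; exact: continuous_ks.
apply: (measurable_prod2 (f := fun x => a * sinh (r * x))); last exact: continuous_bet.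
by move=> t; apply: cvgM; [exact: cvg_cst|exact: continuous_sinh].
Qed.

Section density.
Variable phi : R -> R.
Hypothesis phiL : L1 L phi.

Lemma L1_greenI : L1 L (greenI phi).
Proof.
have gc : {within `[0, L], continuous (dgreen L a phi 0)}.
  apply: isD_continuous => x xL; exists (dgreen L a phi 1 x).
  exact: isD_dgreen.
have := continuous_L1 gc; apply: L1_eq => x xL.
by rewrite /greenI integ_green.
Qed.

Lemma L1_helmI : L1 L (helmI phi).
Proof.
have := L1Z (-1) (continuous_L1 (continuous_dgreen2 L_gt0 a_gt0 phiL)).
by apply: L1_eq => x xL; rewrite /helmI integ_helm// mulN1r.
Qed.

(** By symmetry of the kernel, its integrals over the first variable are responses to a unit load,
    bounded by [integ_green1_le]. *)
Lemma L1norm_greenI : L1norm L (greenI phi) <= L ^+ 2 / (8 * a) * L1norm L phi.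
Proof.
apply: L1norm_integral_le => //.
- exact: measurable_green.
- by move=> t s tL sL; exact: green_ge0.
- by move=> t tL; exact: L1_green.
- move=> s sL; have := L1_green L_gt0 a_gt0 (L1_cst L 1) sL.
  by apply: L1_eq => t _; rewrite mulr1 green_sym.
- exact: L1_greenI.
- move=> s sL; rewrite (integ_eq (g := green L a s)).
    exact: integ_green1_le.
  by move=> t _; rewrite green_sym.
Qed.

Lemma L1norm_helmI : L1norm L (helmI phi) <= a^-1 * L1norm L phi.
Proof.
apply: L1norm_integral_le => //.
- exact: measurable_helm.
- by move=> t s tL sL; exact: helm_ge0.
- by move=> t tL; exact: L1_helm.
- move=> s sL; have := L1_helm L_gt0 a_gt0 (L1_cst L 1) sL.
  by apply: L1_eq => t _; rewrite mulr1 helm_sym.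
- exact: L1_helmI.
- move=> s sL; rewrite (integ_eq (g := helm L a s)).
    by rewrite integ_helm1//; exact: helm1_le.
  by move=> t _; rewrite helm_sym.
Qed.

Lemma helmI_le x : 0 <= x <= L -> `|helmI phi x| <= L * L1norm L phi.
Proof.
move=> xL; have iK := L1_helm L_gt0 a_gt0 phiL xL.
apply: le_trans (normr_integ iK) _; rewrite -[X in _ <= X]integZ; last exact: L1_norm.
apply: le_integ; [exact: L1_norm|by apply: L1Z; exact: L1_norm|move=> s sL].
rewrite normrM ler_wpM2r// ger0_norm; first exact: helm_le_L.
exact: helm_ge0.
Qed.

Lemma greenII_le : `|greenII phi| <= L ^+ 2 / (8 * a) * L1norm L phi.
Proof. by apply: le_trans L1norm_greenI; apply: normr_integ; exact: L1_greenI. Qed.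

(** The value of [c] times the mean term of [S phi]: moving it to the right-hand side leaves the
    Green potential of [phi - load]. *)
Let load : R := c * greenII phi / M.

Lemma L1_load : L1 L (fun s => phi s - load).
Proof. by apply: L1B => //; exact: L1_cst. Qed.

Lemma solSE x : solS L a c phi x = greenI phi x - load * integ L (green L a x).
Proof.
by rewrite /solS -constME -/(greenI _ _) -[integ L (greenI _)]/(greenII phi) /load;
  have M0 := constM_gt0; field; rewrite gt_eqF.
Qed.

Lemma solS_dgreen x : 0 <= x <= L ->
  solS L a c phi x = dgreen L a (fun s => phi s - load) 0 x.
Proof.
move=> xL; rewrite solSE -integ_green//; last exact: L1_load.
have i1 : L1 L (green L a x).
  have := L1_green L_gt0 a_gt0 (L1_cst L 1) xL.
  by apply: L1_eq => t _; rewrite mulr1.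
rewrite -[load * _]integZ// /greenI -integB; [|exact: L1_green|exact: L1Z].
by apply: integ_eq => s _; rewrite mulrBr [load * _]mulrC.
Qed.

Definition solS2 x := load * helm1 L a x - helmI phi x.

Lemma nderiv2_solS x : 0 <= x <= L -> nderiv L 2 (solS L a c phi) x = solS2 x.
Proof.
move=> xL; rewrite (nderiv2_green L_gt0 a_gt0 L1_load solS_dgreen xL).
rewrite -[LHS]opprK -(integ_helm L_gt0 a_gt0 L1_load xL) /solS2 /helmI.
have i1 : L1 L (helm L a x).
  have := L1_helm L_gt0 a_gt0 (L1_cst L 1) xL.
  by apply: L1_eq => t _; rewrite mulr1.
rewrite -integ_helm1// -[load * _]integZ// -integB; [|exact: L1Z|exact: L1_helm].
rewrite -mulN1r -integZ; last by apply: L1_helm => //; exact: L1_load.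
by apply: integ_eq => s _; ring.
Qed.

Lemma W41_solS : W41 L (solS L a c phi).
Proof. exact: W41_green L1_load _ solS_dgreen. Qed.

(** Integrating [S phi] subtracts [load] times the double integral of [green], which by [constME] is
    [(M - 1) / c]. *)
Lemma integ_solS : integ L (solS L a c phi) = greenII phi / M.
Proof.
rewrite (integ_eq (g := fun x => greenI phi x - load * integ L (green L a x))).
  rewrite integB; [|exact: L1_greenI|by apply: L1Z; exact: L1_integ_green].
  rewrite integZ; last exact: L1_integ_green.
  have M0 := constM_gt0; have := constME; rewrite -/(greenII phi) /load.
  move: (integ L _) => J ME; have -> : c * greenII phi / M * J = greenII phi * (c * J) / M.
    by field; rewrite gt_eqF.
  have -> : c * J = M - 1 by rewrite ME; ring.
  by field; rewrite gt_eqF.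
by move=> x _; rewrite solSE.
Qed.

Lemma solS_ode : {ae mu, forall x, x \in `[0, L] -> nderiv L 4 (solS L a c phi) x =
  a * nderiv L 2 (solS L a c phi) x + phi x - c * integ L (solS L a c phi)}.
Proof.
have FF := ae_filter_ringOfSetsType mu.
apply: (@filterS _ _ FF _ _ _ (nderiv4_green L_gt0 a_gt0 L1_load solS_dgreen)) => x H xL.
have xL' : 0 <= x <= L by move: xL; rewrite in_itv.
rewrite H// (nderiv2_green L_gt0 a_gt0 L1_load solS_dgreen xL') integ_solS.
by rewrite /load; ring.
Qed.

Lemma integ_solS_le :
  `|integ L (solS L a c phi)| <= L ^+ 2 / (8 * a * M) * L1norm L phi.
Proof.
have M0 := constM_gt0; rewrite integ_solS normrM normfV (gtr0_norm M0).
rewrite ler_pdivrMr//; apply: le_trans greenII_le _.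
by rewrite le_eqVlt; apply/orP; left; apply/eqP; field; rewrite !gt_eqF.
Qed.

Lemma load_le : `|load| <= c * L ^+ 2 / (8 * a * M) * L1norm L phi.
Proof.
have -> : load = c * integ L (solS L a c phi).
  by rewrite integ_solS /load mulrA.
rewrite normrM (gtr0_norm c_gt0).
apply: le_trans (ler_wpM2l (ltW c_gt0) integ_solS_le) _.
by rewrite !mulrA.
Qed.

(** The potential of [phi] contributes the factor 1 and that of [load] the factor [(M - 1) / M];
    their sum is [(2 * M - 1) / M]. *)
Lemma L1norm_solS : L1norm L (solS L a c phi) <=
  (2 * M - 1) / M * (L ^+ 2 / (8 * a)) * L1norm L phi.
Proof.
have M0 := constM_gt0; have iG := L1_integ_green L_gt0 a_gt0.
have -> : L1norm L (solS L a c phi) =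
    L1norm L (fun x => greenI phi x - load * integ L (green L a x)).
  by apply: L1norm_eq => x _; rewrite solSE.
apply: le_trans (L1normB L1_greenI (L1Z load iG)) _.
rewrite L1normZ//.
have -> : L1norm L (fun x => integ L (green L a x)) = (M - 1) / c.
  rewrite constME addrAC subrr add0r mulrAC mulfV ?gt_eqF// mul1r.
  apply: integ_eq => x xL; rewrite ger0_norm//; apply: Rintegral_ge0 => s /=.
  by rewrite in_itv/= => sL; exact: green_ge0.
have M1 : 0 <= (M - 1) / c by rewrite divr_ge0 ?(ltW c_gt0)// subr_ge0 constM_ge1.
apply: le_trans (lerD L1norm_greenI (ler_wpM2r M1 load_le)) _.
by rewrite le_eqVlt; apply/orP; left; apply/eqP; field; rewrite !gt_eqF.
Qed.

Lemma L1_solS2 : L1 L solS2.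
Proof. by apply: L1B; [apply: L1Z; exact: L1_helm1|exact: L1_helmI]. Qed.

Lemma L1norm_solS2 : L1norm L solS2 <= N / (a * M) * L1norm L phi.
Proof.
have M0 := constM_gt0.
have i1 : L1 L (helm1 L a) by exact: L1_helm1.
apply: le_trans (L1normB (L1Z load i1) L1_helmI) _.
rewrite L1normZ//.
have -> : L1norm L (helm1 L a) = integ L (helm1 L a).
  by apply: integ_eq => x xL; rewrite ger0_norm// helm1_ge0.
apply: le_trans (lerD (ler_wpM2r integ_helm1_ge0 load_le) L1norm_helmI) _.
by rewrite le_eqVlt; apply/orP; left; apply/eqP; rewrite constNE; field; rewrite !gt_eqF.
Qed.

Lemma solS2_le x : 0 <= x <= L ->
  `|solS2 x| <= (c * L ^+ 2 / (8 * a * M) / a + L) * L1norm L phi.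
Proof.
move=> xL; rewrite mulrDl (le_trans (ler_normB _ _))// lerD ?helmI_le//.
rewrite normrM (mulrAC _ a^-1) ler_pM ?load_le//.
by rewrite ger0_norm ?helm1_ge0 ?helm1_le.
Qed.

End density.

Lemma solS2_eq phi psi x : greenII phi = greenII psi ->
  helmI phi x = helmI psi x -> solS2 phi x = solS2 psi x.
Proof. by rewrite /solS2 => -> ->. Qed.

Section difference.
Variables phi psi : R -> R.
Hypotheses (phiL : L1 L phi) (psiL : L1 L psi).

Lemma greenIB x : 0 <= x <= L ->
  greenI (fun s => phi s - psi s) x = greenI phi x - greenI psi x.
Proof.
move=> xL; rewrite /greenI -integB; [|exact: L1_green|exact: L1_green].
by apply: integ_eq => s _; rewrite mulrBr.
Qed.

Lemma greenIIB : greenII (fun s => phi s - psi s) = greenII phi - greenII psi.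
Proof.
rewrite /greenII -integB; [|exact: L1_greenI|exact: L1_greenI].
by apply: integ_eq => x xL; rewrite greenIB.
Qed.

Lemma helmIB x : 0 <= x <= L ->
  helmI (fun s => phi s - psi s) x = helmI phi x - helmI psi x.
Proof.
move=> xL; rewrite /helmI -integB; [|exact: L1_helm|exact: L1_helm].
by apply: integ_eq => s _; rewrite mulrBr.
Qed.

Lemma solS2B x : 0 <= x <= L ->
  solS2 (fun s => phi s - psi s) x = solS2 phi x - solS2 psi x.
Proof. by move=> xL; rewrite /solS2 helmIB// greenIIB; ring. Qed.

Lemma integ_solSB : integ L (solS L a c (fun s => phi s - psi s)) =
  integ L (solS L a c phi) - integ L (solS L a c psi).
Proof. by rewrite !integ_solS ?greenIIB ?mulrBl//; exact: L1B. Qed.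

End difference.

End linear_problem.

(** * Contraction argument for a quadratic map *)

(* A perturbation of [p] by the product of a bounded linear functional [J] and a
   linear operator [U] that is bounded from L^1 to L^1 and to the bounded
   functions. Because of the last bound the Picard iterates converge uniformly
   up to [p], and the completeness of L^1 is not needed. *)
Section quadratic_fixed_point.
Context {R : realType}.
Variables (L b kap nu uinf : R) (p : R -> R).
Variables (J : (R -> R) -> R) (U : (R -> R) -> R -> R).
Hypotheses (L_gt0 : 0 < L) (b_gt0 : 0 < b).
Hypotheses (kap0 : 0 <= kap) (nu0 : 0 <= nu) (uinf0 : 0 <= uinf).
Hypothesis pL : L1 L p.
Implicit Types (phi psi : R -> R) (x s : R).
Local Notation mu := (@lebesgue_measure R).

Hypothesis JB : forall phi psi, L1 L phi -> L1 L psi ->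
  J (fun s => phi s - psi s) = J phi - J psi.
Hypothesis UB : forall phi psi x, L1 L phi -> L1 L psi -> 0 <= x <= L ->
  U (fun s => phi s - psi s) x = U phi x - U psi x.
Hypothesis J_le : forall phi, L1 L phi -> `|J phi| <= kap * L1norm L phi.
Hypothesis UL1 : forall phi, L1 L phi -> L1 L (U phi).
Hypothesis U_le : forall phi, L1 L phi -> L1norm L (U phi) <= nu * L1norm L phi.
Hypothesis U_sup : forall phi x, L1 L phi -> 0 <= x <= L ->
  `|U phi x| <= uinf * L1norm L phi.

Definition quad phi x := p x + b * J phi * U phi x.
Local Notation A := quad.

Let P := L1norm L p.
(** The Lipschitz constant on the ball of radius [2 * P]: each of the two terms in the difference of
    a product contributes [b * kap * nu * (2 * P)]. *)
Let q := 4 * (b * (kap * nu)) * P.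
Let P0 : 0 <= P. Proof. exact: L1norm_ge0. Qed.
Let bkn0 : 0 <= b * (kap * nu).
Proof. by rewrite mulr_ge0 ?(ltW b_gt0)// mulr_ge0. Qed.
Let q0 : 0 <= q.
Proof. by rewrite mulr_ge0// mulr_ge0. Qed.

Lemma L1_quad phi : L1 L phi -> L1 L (A phi).
Proof. by move=> phiL; apply: L1D => //; apply: L1Z; exact: UL1. Qed.

(** On the ball the quadratic term has norm at most [b * kap * nu * (2 * P) ^+ 2 = q * P <= P], and
    [p] itself has norm [P]. *)
Lemma quad_ball phi : q <= 1 -> L1ball L (2 * P) phi -> L1ball L (2 * P) (A phi).
Proof.
move=> q1 [phiL phiP]; split; first exact: L1_quad.
have UL : L1 L (U phi) by exact: UL1.
apply: le_trans (L1normD pL (L1Z _ UL)) _; rewrite L1normZ// normrM (gtr0_norm b_gt0).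
have n0 := L1norm_ge0 L phi.
have H1 : `|J phi| <= kap * (2 * P).
  by apply: le_trans (J_le phiL) _; rewrite ler_wpM2l.
have H2 : L1norm L (U phi) <= nu * (2 * P).
  by apply: le_trans (U_le phiL) _; rewrite ler_wpM2l.
have H3 := ler_wpM2l (ltW b_gt0) (ler_pM (normr_ge0 _) (L1norm_ge0 _ _) H1 H2).
have := ler_wpM2r P0 q1; move: H3; rewrite /q -/P; lra.
Qed.

Lemma quad_diff phi psi x : L1 L phi -> L1 L psi -> 0 <= x <= L ->
  A phi x - A psi x =
    b * J (fun s => phi s - psi s) * U phi x +
    b * J psi * U (fun s => phi s - psi s) x.
Proof. by move=> phiL psiL xL; rewrite JB// UB// /quad; ring. Qed.

Lemma quad_contraction phi psi : L1ball L (2 * P) phi -> L1ball L (2 * P) psi ->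
  L1norm L (fun x => A phi x - A psi x) <= q * L1norm L (fun x => phi x - psi x).
Proof.
move=> [phiL phiP] [psiL psiP]; have dL := L1B phiL psiL.
pose D := L1norm L (fun x => phi x - psi x).
have UL : L1 L (U phi) by exact: UL1.
have VL : L1 L (U (fun s => phi s - psi s)) by exact: UL1.
rewrite (L1norm_eq (g := fun x => b * J (fun s => phi s - psi s) * U phi x +
    b * J psi * U (fun s => phi s - psi s) x)); last first.
  by move=> x xL; exact: quad_diff.
apply: le_trans (L1normD (L1Z _ UL) (L1Z _ VL)) _.
rewrite !L1normZ// !normrM (gtr0_norm b_gt0).
have D0 : 0 <= D by exact: L1norm_ge0.
have H1 : `|J (fun s => phi s - psi s)| <= kap * D by exact: J_le.
have H2 : L1norm L (U phi) <= nu * (2 * P).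
  by apply: le_trans (U_le phiL) _; rewrite ler_wpM2l.
have H3 : `|J psi| <= kap * (2 * P).
  by apply: le_trans (J_le psiL) _; rewrite ler_wpM2l.
have H4 : L1norm L (U (fun s => phi s - psi s)) <= nu * D by exact: U_le.
have E1 := ler_wpM2l (ltW b_gt0) (ler_pM (normr_ge0 _) (L1norm_ge0 _ _) H1 H2).
have E2 := ler_wpM2l (ltW b_gt0) (ler_pM (normr_ge0 _) (L1norm_ge0 _ _) H3 H4).
by move: E1 E2; rewrite /q -/D; lra.
Qed.

(** The term [p], possibly unbounded, cancels in the difference of two images, which is thus bounded
    pointwise by an L^1 distance. *)
Lemma quad_uniform phi psi x : L1ball L (2 * P) phi -> L1ball L (2 * P) psi ->
  0 <= x <= L ->
  `|A phi x - A psi x| <=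
    4 * (b * (kap * uinf)) * P * L1norm L (fun x => phi x - psi x).
Proof.
move=> [phiL phiP] [psiL psiP] xL; have dL := L1B phiL psiL.
pose D := L1norm L (fun x => phi x - psi x).
have D0 : 0 <= D by exact: L1norm_ge0.
rewrite quad_diff// (le_trans (ler_normD _ _))// !normrM (gtr0_norm b_gt0) -/D.
have H1 : `|J (fun s => phi s - psi s)| <= kap * D by exact: J_le.
have H2 : `|U phi x| <= uinf * (2 * P).
  by apply: le_trans (U_sup phiL xL) _; rewrite ler_wpM2l.
have H3 : `|J psi| <= kap * (2 * P).
  by apply: le_trans (J_le psiL) _; rewrite ler_wpM2l.
have H4 : `|U (fun s => phi s - psi s) x| <= uinf * D by exact: U_sup.
have E1 := ler_wpM2l (ltW b_gt0) (ler_pM (normr_ge0 _) (normr_ge0 _) H1 H2).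
have E2 := ler_wpM2l (ltW b_gt0) (ler_pM (normr_ge0 _) (normr_ge0 _) H3 H4).
by move: E1 E2; lra.
Qed.

Lemma geometric_small (C e : R) : q < 1 -> 0 <= C -> 0 < e ->
  exists n, C * q ^+ n <= e.
Proof.
move=> q1 C0 e0; have C1 : 0 < C + 1 by rewrite ltr_wpDl.
have qn : `|q| < 1 by rewrite ger0_norm.
have /cvgrPdist_le/(_ (e / (C + 1)) (divr_gt0 e0 C1))[n _ H] := cvg_expr qn.
exists n; have := H n (leqnn n); rewrite sub0r normrN ger0_norm ?exprn_ge0//.
rewrite ler_pdivlMr// => /(le_trans _); apply; rewrite mulrC.
by rewrite ler_wpM2l ?exprn_ge0// lerDl.
Qed.

Lemma quad_fixed_point : q < 1 -> exists phi,
  L1ball L (2 * P) phi /\ forall x, 0 <= x <= L -> A phi x = phi x.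
Proof.
move=> q1; pose f n := iter n A (fun=> 0).
have fB n : L1ball L (2 * P) (f n).
  elim: n => [|n IH]; last exact: quad_ball (ltW q1) IH.
  split; first exact: L1_cst.
  rewrite (L1norm_eq (g := fun x => 0 * (fun=> 0) x)); last by move=> x _; rewrite mulr0.
  by rewrite L1normZ ?normr0 ?mul0r ?mulr_ge0//; exact: L1_cst.
have fL n : L1 L (f n) by case: (fB n).
pose D := L1norm L (fun x => f 1%N x - f 0%N x).
have D0 : 0 <= D by exact: L1norm_ge0.
have fD n : L1norm L (fun x => f n.+1 x - f n x) <= q ^+ n * D.
  elim: n => [|n IH]; first by rewrite expr0 mul1r.
  apply: le_trans (quad_contraction (fB n.+1) (fB n)) _.
  by rewrite exprS -mulrA ler_wpM2l.
pose C := 4 * (b * (kap * uinf)) * P.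
have C0 : 0 <= C by rewrite !mulr_ge0 ?(ltW b_gt0).
have q1' : 0 < 1 - q by rewrite subr_gt0.
pose E := C * D / (1 - q).
have E0 : 0 <= E by apply: divr_ge0; [exact: mulr_ge0|exact: ltW].
(* The right-hand side is the partial geometric sum in closed form, so that the induction on [k] is
   an identity. Indices start at 1 because [f 1 - f 0] contains [p], which need not be bounded. *)
have vD x n k : 0 <= x <= L -> `|f (n + k).+1 x - f n.+1 x| <= E * q ^+ n * (1 - q ^+ k).
  move=> xL; elim: k => [|k IH].
    by rewrite addn0 subrr normr0 expr0 subrr mulr0.
  rewrite addnS -(subrK (f (n + k).+1 x) (f (n + k).+2 x)) -addrA.
  apply: le_trans (ler_normD _ _) _.
  have H := quad_uniform (fB (n + k).+1) (fB (n + k)) xL.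
  have {}H := le_trans H (ler_wpM2l C0 (fD (n + k)%N)).
  apply: le_trans (lerD H IH) _.
  rewrite le_eqVlt; apply/orP; left; apply/eqP; rewrite /E exprD exprS.
  by field; rewrite gt_eqF.
have vD' x n m : 0 <= x <= L -> (n <= m)%N -> `|f m.+1 x - f n.+1 x| <= E * q ^+ n.
  move=> xL nm; rewrite -(subnKC nm); apply: le_trans (vD _ _ _ xL) _.
  apply: ler_piMr; first by apply: mulr_ge0 => //; exact: exprn_ge0.
  by rewrite lerBlDr lerDl exprn_ge0.
have vcvg x : 0 <= x <= L -> cvg (f n.+1 x @[n --> \oo]).
  move=> xL; apply: cauchy_cvg; apply: cauchy_exP => e e0.
  have [n Hn] := geometric_small q1 E0 (divr_gt0 e0 (ltr0n _ 2)).
  exists (f n.+1 x); exists n => // m /= nm; rewrite /ball/= distrC.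
  apply: le_lt_trans (vD' _ _ _ xL nm) _; apply: le_lt_trans Hn _.
  by rewrite gtr_pMr// invf_lt1// ltr1n.
pose phi x := lim (f n.+1 x @[n --> \oo]).
have phiD x n : 0 <= x <= L -> `|phi x - f n.+1 x| <= E * q ^+ n.
  move=> xL; apply/ler_addgt0Pl => e e0.
  have /cvgrPdist_le/(_ e e0)[m _ H] := vcvg x xL.
  have := H (maxn m n) (leq_maxl _ _) => H1.
  rewrite -(subrK (f (maxn m n).+1 x) (phi x)) -addrA.
  by apply: le_trans (ler_normD _ _) _; rewrite lerD// vD'// leq_maxr.
have phiL : L1 L phi.
  have bL : L1 L (fun x => `|f 1%N x| + E).
    by apply: L1D; [exact: L1_norm|exact: L1_cst].
  apply: le_integrable bL => //.
    apply/measurable_EFinP; apply: (@measurable_fun_cvg _ _ _ _ (fun n => f n.+1)).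
    - by move=> n; exact: L1_measurable.
    - by move=> x /=; rewrite in_itv/= => xL; exact: vcvg.
  move=> x /=; rewrite in_itv/= => xL; rewrite lee_fin.
  rewrite [leRHS]ger0_norm ?addr_ge0// addrC -(subrK (f 1%N x) (phi x)).
  apply: le_trans (ler_normD _ _) _; rewrite lerD2r.
  by have := phiD x 0%N xL; rewrite expr0 mulr1.
have phif n : L1norm L (fun x => phi x - f n.+1 x) <= E * q ^+ n * L.
  rewrite -integ_cst//; apply: le_L1norm => [||x xL]; last exact: phiD.
    exact: L1B.
  exact: L1_cst.
have phiB : L1ball L (2 * P) phi.
  split=> //; apply/ler_addgt0Pl => e e0.
  have [n Hn] := geometric_small q1 (mulr_ge0 E0 (ltW L_gt0)) e0.
  rewrite (L1norm_eq (g := fun x => (phi x - f n.+1 x) + f n.+1 x)); last first.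
    by move=> x _; rewrite subrK.
  apply: le_trans (L1normD (L1B phiL (fL n.+1)) (fL n.+1)) _.
  apply: lerD; last by case: (fB n.+1).
  by apply: le_trans (phif n) _; rewrite mulrAC.
exists phi; split=> // x xL; apply/eqP; rewrite -subr_eq0 -normr_le0.
apply/ler_addgt0Pl => e e0; rewrite addr0.
have [n Hn] := geometric_small q1 (addr_ge0 (mulr_ge0 C0 (mulr_ge0 E0 (ltW L_gt0))) E0) e0.
(* [A phi] is compared with [A (f n.+1)], the next iterate, and that one with [phi]. Both errors are
   uniform in [x], so [phi] is fixed at every point and not merely almost everywhere. *)
apply: le_trans Hn; rewrite -(subrK (A (f n.+1) x) (A phi x)) -addrA.
apply: le_trans (ler_normD _ _) _; rewrite mulrDl lerD//.
  apply: le_trans (quad_uniform phiB (fB n.+1) xL) _.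
  apply: le_trans (ler_wpM2l C0 (phif n)) _.
  by rewrite le_eqVlt; apply/orP; left; apply/eqP; ring.
rewrite distrC; apply: le_trans (phiD x n.+1 xL) _; rewrite exprS.
rewrite mulrCA; apply: ler_piMl; last exact: ltW.
by apply: mulr_ge0 => //; exact: exprn_ge0.
Qed.

(** [psi] is fixed only in L^1, which still gives [d <= q * d] for the distance [d] to [phi]; so
    [d = 0], and a function of norm 0 vanishes almost everywhere. *)
Lemma quad_fixed_point_unique phi psi : q < 1 ->
  L1ball L (2 * P) phi -> (forall x, 0 <= x <= L -> A phi x = phi x) ->
  L1ball L (2 * P) psi -> L1eq L (A psi) psi -> L1eq L psi phi.
Proof.
move=> q1 phiB phiA psiB psiA; have [phiL _] := phiB; have [psiL _] := psiB.
have FF := ae_filter_ringOfSetsType mu.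
have dL := L1B psiL phiL.
have E : L1norm L (fun x => A psi x - A phi x) = L1norm L (fun x => psi x - phi x).
  apply: L1norm_ae_eq => //; apply: (@filterS _ _ FF _ _ _ psiA) => x H xL.
  by rewrite H// phiA//; move: xL; rewrite /= in_itv.
have := quad_contraction psiB phiB; rewrite E.
have n0 := L1norm_ge0 L (fun x => psi x - phi x) => H.
have {H} H0 : L1norm L (fun x => psi x - phi x) = 0.
  apply/eqP; rewrite eq_le n0 andbT leNgt; apply/negP => n1.
  by move: H; rewrite leNgt gtr_pMl// q1.
pose d x := psi x - phi x.
have I0 : (\int[mu]_(x in `[0%R, L]) `|(EFin \o d) x| = 0)%E.
  by have := EFin_integ (L1_norm dL); rewrite -L1norm_integ H0 => /esym.
have mf : measurable_fun `[0, L] (EFin \o d).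
  by apply/measurable_EFinP; exact: L1_measurable.
have /(ae_eq_integral_abs mu _ mf) := I0.
move=> /(_ (measurable_itv _)) H.
apply: (@filterS _ _ FF _ _ _ H) => x Hx xL.
by have := Hx xL => /= -[] /eqP; rewrite subr_eq0 => /eqP.
Qed.

End quadratic_fixed_point.

(** * The beam operator and its fixed point *)

Section beam_operator.
Context {R : realType}.
Variables (L a b c : R) (p : R -> R).
Hypotheses (L_gt0 : 0 < L) (a_gt0 : 0 < a) (b_gt0 : 0 < b) (c_gt0 : 0 < c).
Hypothesis pL : L1 L p.
Implicit Types (phi psi : R -> R) (x s : R).
Local Notation mu := (@lebesgue_measure R).
Local Notation M := (constM L a c).
Local Notation N := (constN L a c).
Local Notation J := (fun phi => integ L (solS L a c phi)).
Local Notation quadA := (quad b p J (solS2 L a c)).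

Lemma opA_quad phi x : L1 L phi -> 0 <= x <= L -> opA L a b c p phi x = quadA phi x.
Proof. by move=> phiL xL; rewrite /opA nderiv2_solS. Qed.

Lemma L1_opA phi : L1 L phi -> L1 L (opA L a b c p phi).
Proof.
move=> phiL; apply: (@L1_eq _ _ (quadA phi)).
  by move=> x xL; rewrite opA_quad.
by apply: L1_quad => // psi psiL; exact: L1_solS2.
Qed.


(** The density enters only through integrals against the kernels, so a change on a null set leaves
    [opA] unchanged at every point of [0, L]. *)
Lemma opA_ae_eq phi psi : L1 L phi -> L1 L psi -> L1eq L phi psi ->
  L1eq L (opA L a b c p phi) (opA L a b c p psi).
Proof.
move=> phiL psiL e; have FF := ae_filter_ringOfSetsType mu.
have gE x : 0 <= x <= L -> greenI L a phi x = greenI L a psi x.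
  move=> xL; apply: ae_eq_integ; [exact: L1_green|exact: L1_green|].
  by apply: (@filterS _ _ FF _ _ _ e) => s H sL; rewrite H.
have hE x : 0 <= x <= L -> helmI L a phi x = helmI L a psi x.
  move=> xL; apply: ae_eq_integ; [exact: L1_helm|exact: L1_helm|].
  by apply: (@filterS _ _ FF _ _ _ e) => s H sL; rewrite H.
have GE : greenII L a phi = greenII L a psi by exact: integ_eq.
have JE : J phi = J psi by rewrite (integ_solS L_gt0 a_gt0 c_gt0 phiL)
  (integ_solS L_gt0 a_gt0 c_gt0 psiL) GE.
apply: aeW => x /=; rewrite in_itv/= => xL.
by rewrite (opA_quad phiL xL) (opA_quad psiL xL) /quad JE (solS2_eq c GE (hE x xL)).
Qed.

Lemma opA_picard : L1norm L p < 2 * a ^+ 2 * M ^+ 2 / (b * L ^+ 2 * N) ->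
  exists phi, [/\ L1ball L (2 * L1norm L p) phi,
    forall x, 0 <= x <= L -> opA L a b c p phi x = phi x
  & forall psi, L1ball L (2 * L1norm L p) psi ->
      L1eq L (opA L a b c p psi) psi -> L1eq L psi phi].
Proof.
move=> p_small; have M0 := constM_gt0 L_gt0 a_gt0 c_gt0.
have N0 := constN_gt0 L_gt0 a_gt0 c_gt0.
have kap0 : 0 <= L ^+ 2 / (8 * a * M).
  by rewrite divr_ge0 ?sqr_ge0// mulr_ge0 ?(ltW M0)// mulr_ge0// ltW.
have nu0 : 0 <= N / (a * M).
  by rewrite divr_ge0 ?(ltW N0)// mulr_ge0 ?(ltW M0)// ltW.
have uinf0 : 0 <= c * L ^+ 2 / (8 * a * M) / a + L.
  rewrite addr_ge0 ?(ltW L_gt0)// divr_ge0 ?(ltW a_gt0)// -mulrA.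
  by rewrite mulr_ge0 ?(ltW c_gt0).
(* With these values of [kap] and [nu] the contraction constant is [b * L ^+ 2 * N * |p|_1 / (2 * a
   ^+ 2 * M ^+ 2)], and [p_small] says exactly that it is less than 1. *)
have q1 : 4 * (b * (L ^+ 2 / (8 * a * M) * (N / (a * M)))) * L1norm L p < 1.
  have D0 : 0 < b * L ^+ 2 * N by rewrite mulr_gt0// mulr_gt0// exprn_gt0.
  have D1 : 0 < 2 * a ^+ 2 * M ^+ 2 by rewrite !mulr_gt0// exprn_gt0.
  move: p_small; rewrite ltr_pdivlMr// => H.
  have -> : 4 * (b * (L ^+ 2 / (8 * a * M) * (N / (a * M)))) * L1norm L p =
    (L1norm L p * (b * L ^+ 2 * N)) / (2 * a ^+ 2 * M ^+ 2).
    by field; rewrite !gt_eqF.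
  by rewrite ltr_pdivrMr// mul1r.
have JB phi psi : L1 L phi -> L1 L psi -> J (fun s => phi s - psi s) = J phi - J psi.
  by move=> phiL psiL; exact: integ_solSB.
have UB phi psi x : L1 L phi -> L1 L psi -> 0 <= x <= L ->
    solS2 L a c (fun s => phi s - psi s) x = solS2 L a c phi x - solS2 L a c psi x.
  by move=> phiL psiL xL; exact: solS2B.
have Jle phi : L1 L phi -> `|J phi| <= L ^+ 2 / (8 * a * M) * L1norm L phi.
  by move=> phiL; exact: integ_solS_le.
have UL phi : L1 L phi -> L1 L (solS2 L a c phi) by move=> phiL; exact: L1_solS2.
have Ule phi : L1 L phi -> L1norm L (solS2 L a c phi) <= N / (a * M) * L1norm L phi.
  by move=> phiL; exact: L1norm_solS2.
have Usup phi x : L1 L phi -> 0 <= x <= L -> `|solS2 L a c phi x| <=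
    (c * L ^+ 2 / (8 * a * M) / a + L) * L1norm L phi.
  by move=> phiL xL; exact: solS2_le.
have [phi [phiB phiA]] :=
  quad_fixed_point L_gt0 b_gt0 kap0 nu0 uinf0 pL JB UB Jle UL Ule Usup q1.
have [phiL _] := phiB; exists phi; split=> //.
  by move=> x xL; rewrite opA_quad// phiA.
move=> psi psiB psiA; have [psiL _] := psiB.
apply: (quad_fixed_point_unique b_gt0 kap0 nu0 JB UB Jle UL Ule q1 phiB phiA psiB).
have FF := ae_filter_ringOfSetsType mu.
apply: (@filterS _ _ FF _ _ _ psiA) => x H xL.
by rewrite -(H xL) opA_quad//; move: xL; rewrite /= in_itv.
Qed.

Lemma solS_endpoints phi : L1 L phi ->
  [/\ solS L a c phi 0 = 0, solS L a c phi L = 0,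
      nderiv L 2 (solS L a c phi) 0 = 0 & nderiv L 2 (solS L a c phi) L = 0].
Proof.
move=> phiL; have L00 : 0 <= (0 : R) <= L by rewrite lexx ltW.
have LL : 0 <= L <= L by rewrite lexx ltW.
have z0 : integ L (fun=> 0) = 0 by rewrite integ_cst// mul0r.
have g0 s : 0 <= s <= L -> green L a 0 s = 0.
  by move=> /andP[s0 _]; rewrite /green s0 /green_le mulr0 sinh0 !mul0r subrr.
have gL s : 0 <= s <= L -> green L a L s = 0.
  move=> /andP[_ sL]; rewrite green_sym /green sL /green_le subrr !mulr0 sinh0.
  by rewrite mulr0 !mul0r subrr.
have h0 s : 0 <= s <= L -> helm L a 0 s = 0.
  by move=> /andP[s0 _]; rewrite /helm s0 /helm_le mulr0 sinh0 !mul0r.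
have hL s : 0 <= s <= L -> helm L a L s = 0.
  move=> /andP[_ sL]; rewrite helm_sym /helm sL /helm_le subrr mulr0 sinh0.
  by rewrite mulr0 mul0r.
have zero (f g : R -> R) : (forall s, 0 <= s <= L -> f s = 0) ->
    integ L (fun s => f s * g s) = 0.
  by move=> f0; rewrite -z0; apply: integ_eq => s sL; rewrite f0// mul0r.
have zero1 (f : R -> R) : (forall s, 0 <= s <= L -> f s = 0) -> integ L f = 0.
  by move=> f0; rewrite -z0; exact: integ_eq.
split.
- by rewrite solSE// /greenI zero// zero1// mulr0 subrr.
- by rewrite solSE// /greenI zero// zero1// mulr0 subrr.
- by rewrite nderiv2_solS// /solS2 /helmI zero// -integ_helm1// zero1// mulr0 subrr.
- by rewrite nderiv2_solS// /solS2 /helmI zero// -integ_helm1// zero1// mulr0 subrr.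
Qed.

(** Replacing [phi] by [A phi] in the linear equation for [S phi] produces the nonlinear term
    [b * integ w * w'']. *)
Lemma solS_beam_bvp phi : L1 L phi ->
  (forall x, 0 <= x <= L -> opA L a b c p phi x = phi x) ->
  beam_bvp L a b c p (solS L a c phi).
Proof.
move=> phiL phiA; split; last exact: solS_endpoints.
have FF := ae_filter_ringOfSetsType mu.
apply: (@filterS _ _ FF _ _ _ (solS_ode L_gt0 a_gt0 c_gt0 phiL)) => x H xI.
have /andP[/ltW x0 /ltW xL] : 0 < x < L by move: xI; rewrite in_itv.
have xL' : 0 <= x <= L by rewrite x0.
rewrite H; last by rewrite in_itv.
rewrite -[phi x](phiA x xL') /opA.
move: (integ _ _) (nderiv _ _ _ _) => i d; ring.
Qed.

End beam_operator.

Unset Implicit Arguments.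

Theorem theorem3p1 (R : realType) (L a b c : R) (p : R -> R)
    (L_gt0 : 0 < L) (a_gt0 : 0 < a) (b_gt0 : 0 < b) (c_gt0 : 0 < c)
    (p_L1 : L1 L p)
    (p_small : L1norm L p < 2 * a ^+ 2 * constM L a c ^+ 2
                            / (b * L ^+ 2 * constN L a c)) :
  (* A is a well-defined operator from L^1[0, L] to L^1[0, L] *)
  (forall phi, L1 L phi -> L1 L (opA L a b c p phi)) /\
  (forall phi psi, L1 L phi -> L1 L psi ->
     L1eq L phi psi -> L1eq L (opA L a b c p phi) (opA L a b c p psi)) /\
  W41_compactly_embedded_in_C2 L /\
  exists phi : R -> R,
    [/\ L1ball L (2 * L1norm L p) phi,
        L1eq L (opA L a b c p phi) phi
      & forall psi : R -> R, L1ball L (2 * L1norm L p) psi ->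
          L1eq L (opA L a b c p psi) psi ->
          L1eq L psi phi]
    /\ [/\ W41 L (solS L a c phi),
        beam_bvp L a b c p (solS L a c phi),
        L1norm L (solS L a c phi)
          <= (2 * constM L a c - 1) / constM L a c
             * (L ^+ 2 / (4 * a)) * L1norm L p
      & L1norm L (nderiv L 2 (solS L a c phi))
          <= constN L a c / (a * constM L a c) * (2 * L1norm L p)].
Proof.
split; first exact: L1_opA.
split; first exact: opA_ae_eq.
split; first exact: W41_compact_C2.
have [phi [phiB phiA phi_uniq]] := opA_picard L_gt0 a_gt0 b_gt0 c_gt0 p_L1 p_small.
have [phiL phi_le] := phiB.
have M0 := constM_gt0 L_gt0 a_gt0 c_gt0; have M1 := constM_ge1 L_gt0 a_gt0 c_gt0.
have N0 := constN_gt0 L_gt0 a_gt0 c_gt0.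
exists phi; split; split => //.
- by apply: aeW => x /=; rewrite in_itv/= => xL; rewrite phiA.
- exact: W41_solS.
- exact: solS_beam_bvp.
- apply: le_trans (L1norm_solS L_gt0 a_gt0 c_gt0 phiL) _.
  (* The factor 2 in the radius of the ball turns [8 * a] into [4 * a]. *)
  have -> : (2 * constM L a c - 1) / constM L a c * (L ^+ 2 / (4 * a)) * L1norm L p =
      (2 * constM L a c - 1) / constM L a c * (L ^+ 2 / (8 * a)) * (2 * L1norm L p).
    by field; rewrite !gt_eqF.
  apply: ler_wpM2l => //; apply: mulr_ge0.
    by apply: divr_ge0; [lra|exact: ltW].
  by apply: divr_ge0; [exact: sqr_ge0|rewrite mulr_ge0// ltW].
- rewrite (L1norm_eq (g := solS2 L a c phi)); last by move=> x xL; exact: nderiv2_solS.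
  apply: le_trans (L1norm_solS2 L_gt0 a_gt0 c_gt0 phiL) _.
  apply: ler_wpM2l => //; apply: divr_ge0; first exact: ltW.
  by rewrite mulr_ge0// ltW.
Qed.
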